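(* Let $(M,F)$ be a connected non-Riemannian Finsler manifold of dimension $n$, and suppose that $\nabla$ is a semi-symmetric linear connection on $M$ compatible with $F$, with torsion $T(X,Y)=\rho(Y)X-\rho(X)Y$ for a differential $1$-form $\rho$ on $M$. Let $p\in M$, and let $u^1,\dots,u^n$ be a normal coordinate system around $p$ with respect to the averaged Riemannian metric $\gamma$, with $(\partial/\partial u^1(p),\dots,\partial/\partial u^n(p))$ orthonormal with respect to $\gamma_p$. Write $\rho_k=\rho(\partial/\partial u^k)(p)$, so that the torsion components at $p$ are $T_{ij}^k=\delta_i^k\rho_j-\delta_j^k\rho_i$. Let $v=[v^1,\dots,v^n]\in T_pM\setminus\{\mathbf 0\}$ be a not vertically contact vector, put $\widetilde v:=v^1+\dots+v^n$, and let $\varepsilon>0$ with $\varepsilon\notin\{0,\widetilde v\}$ be the radius of a closed ball (with respect to $\gamma_p$) around $v$ in $T_pM$, contained in $T_pM\setminus\{\mathbf 0\}$, all of whose elements are not vertically contact. Let $i\neq j$ be indices such that $f_{ij}(w)\neq 0$ for every $w$ in this closed ball. For $l=1,\dots,n$ put $w_l:=[v^1,\dots,v^{l-1},v^l-\varepsilon,v^{l+1},\dots,v^n]$. Then for every $k=1,\dots,n$, $$\rho_k=\frac{1}{\varepsilon}\left(\frac{1}{\widetilde v-\varepsilon}\sum_{l=1}^n v^l\,\frac{f^h_{ji}(w_l)}{f_{ji}(w_l)}-\frac{f^h_{ji}(w_k)}{f_{ji}(w_k)}\right),$$ where $$f^h_{ji}=y^j\frac{\partial F}{\partial x^i}-y^i\frac{\partial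 F}{\partial x^j},\qquad f_{ji}=y^j\frac{\partial F}{\partial y^i}-y^i\frac{\partial F}{\partial y^j}.$$
   Context: Local coordinates $u^1,\dots,u^n$ on $M$ induce coordinates $x^i=u^i\circ\pi$, $y^i(v)=v(u^i)$ on $TM$, where $\pi\colon TM\to M$ is the canonical projection. Vectors in $T_pM$ are written by their coordinates $[v^1,\dots,v^n]$ with respect to $\partial/\partial u^1(p),\dots,\partial/\partial u^n(p)$. A Finsler metric is a non-negative continuous function $F\colon TM\to\mathbb R$, smooth on the complement of the zero section, with $F(tv)=tF(v)$ for $t>0$, $F(v)=0$ iff $v=\mathbf 0$, and such that the Hessian $g_{ij}=\frac{\partial^2 E}{\partial y^i\partial y^j}$ of $E=F^2/2$ is positive definite at all nonzero $v$. $(M,F)$ is non-Riemannian if $F$ is not the norm function of a Riemannian metric on $M$. A linear connection on $M$ is compatible with $F$ if its parallel transports preserve the Finslerian length $F(v)$ of tangent vectors. A linear connection is semi-symmetric if its torsion tensor can be written as $T(X,Y)=\rho(Y)X-\rho(X)Y$ for some differential $1$-form $\rho$ on $M$, where $T(X,Y)=\nabla_XY-\nabla_YX-[X,Y]$. The averaged Riemannian metric $\gamma$ of $F$ is $\gamma_p(X,Y)=\int_{S_p} g_{ij}(v)X^iY^j\,d\mu_p(v)$, where $S_p=\{v\in T_pM: F(v)=1\}$ and $\mu_p$ is the volume measure induced on $S_p$ by the Riemannian metric $g_{ij}$ on $T_pM\setminus\{\mathbf 0\}$. In the given normal coordinates around $p$, for $v\in T_pM\setminus\{\mathbf 0\}$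 let $G_v=[\frac{\partial F}{\partial y^1}(v),\dots,\frac{\partial F}{\partial y^n}(v)]$ and $C_v=[v^1,\dots,v^n]$. The vector $v$ is vertically contact if $G_v$ and $C_v$ are parallel (linearly dependent), and not vertically contact otherwise. Also $f_{ij}=y^i\frac{\partial F}{\partial y^j}-y^j\frac{\partial F}{\partial y^i}$. *)

(* Defs.v *)
From HB Require Import structures.
From mathcomp Require Import all_boot all_order all_algebra.
From mathcomp Require Import all_classical all_reals all_analysis.

Set Implicit Arguments.
Unset Strict Implicit.
Unset Printing Implicit Defensive.

Import Order.TTheory GRing.Theory Num.Theory.
Import numFieldNormedType.Exports.

Local Open Scope classical_set_scope.
Local Open Scope ring_scope.

(* Only used on open sets [U]. *)
Fixpoint Ck_on (R : realType) (V W : normedModType R) (k : nat) (U : set V)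
    (f : V -> W) : Prop :=
  match k with
  | 0%N => forall x, U x -> {for x, continuous f}
  | k'.+1 => (forall x, U x -> differentiable f x) /\
             (forall v, Ck_on k' U (fun x => 'D_v f x))
  end.

Definition smooth_on (R : realType) (V W : normedModType R) (U : set V)
    (f : V -> W) : Prop := forall k, Ck_on k U f.

Definition unit_row (R : realType) (n : nat) (i : 'I_n) : 'rV[R]_n :=
  delta_mx 0 i.

(* The values of [chart_map] off [chart_dom] and of [chart_inv] off the image
   of [chart_dom] are irrelevant. *)
Record chart (R : realType) (n : nat) (M : topologicalType) := Chart {
  chart_dom : set M;
  chart_map :> M -> 'rV[R]_n;
  chart_inv : 'rV[R]_n -> M;
  chart_dom_open : open chart_dom;
  chart_img_open : open (chart_map @` chart_dom);
  chart_mapK : forall q, chart_dom q -> chart_inv (chart_map q) = q;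
  chart_map_cont : forall q, chart_dom q -> {for q, continuous chart_map};
  chart_inv_cont : forall x, (chart_map @` chart_dom) x ->
    {for x, continuous chart_inv} }.

Definition open_interval (R : realType) (I : set R) : Prop :=
  open I /\ is_interval I.

(* Lebesgue integral over R^m of a nonnegative Borel function, as an iterated
   integral (Tonelli). *)
Fixpoint lebesgue_iint (R : realType) (m : nat) :
    ('rV[R]_m -> \bar R) -> \bar R :=
  match m with
  | 0%N => fun f => f 0
  | m'.+1 => fun f => (\int[@lebesgue_measure R]_x
      lebesgue_iint (fun y : 'rV[R]_m' => f (row_mx x%:M y)))%E
  end.

Definition borel_rV (R : realType) (n : nat) :=
  g_sigma_algebraType (@open 'rV[R]_n).

Section Charts.
Variables (R : realType) (n : nat) (M : topologicalType).

Definition chart_img (phi : chart R n M) : set 'rV[R]_n := phi @` chart_dom phi.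

Definition transition (phi psi : chart R n M) : 'rV[R]_n -> 'rV[R]_n :=
  fun x => psi (chart_inv phi x).

Definition chart_compatible (phi psi : chart R n M) : Prop :=
  smooth_on (phi @` (chart_dom phi `&` chart_dom psi)) (transition phi psi) /\
  smooth_on (psi @` (chart_dom phi `&` chart_dom psi)) (transition psi phi).

End Charts.

(* [atlas] is the maximal atlas, so that its elements are all the local
   coordinate systems of the manifold. *)
Record smooth_manifold (R : realType) (n : nat) (M : topologicalType) :=
  SmoothManifold {
    manifold_hausdorff : hausdorff_space M;
    manifold_countable : @second_countable M;
    atlas : set (chart R n M);
    chart_at : M -> chart R n M;
    chart_at_atlas : forall p, atlas (chart_at p);
    chart_at_dom : forall p, chart_dom (chart_at p) p;
    atlas_compatible : forall phi psi, atlas phi -> atlas psi ->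
      chart_compatible phi psi;
    atlas_maximal : forall phi,
      (forall psi, atlas psi -> chart_compatible phi psi) -> atlas phi }.

Section Geometry.
Variables (R : realType) (n : nat) (M : topologicalType).
Variable S : smooth_manifold R n M.
Local Notation field := (M -> 'rV[R]_n).

(* A tangent vector at [p] is represented by its coordinates in the chart
   [chart_at S p], which identifies T_pM with R^n as a vector space.  The maps
   [tcoord] and [tvec] convert to and from the coordinates with respect to the
   basis d/du^1(p), ..., d/du^n(p) of an arbitrary chart u around p. *)
Definition tcoord (u : chart R n M) (p : M) (v : 'rV[R]_n) : 'rV[R]_n :=
  'd (transition (chart_at S p) u) (chart_at S p p) v.

Definition tvec (u : chart R n M) (p : M) (y : 'rV[R]_n) : 'rV[R]_n :=
  'd (transition u (chart_at S p)) (u p) y.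

Definition coord_field (u : chart R n M) (i : 'I_n) (p : M) : 'rV[R]_n :=
  tvec u p (unit_row R i).

Definition field_loc (u : chart R n M) (X : field) (x : 'rV[R]_n) : 'rV[R]_n :=
  tcoord u (chart_inv u x) (X (chart_inv u x)).

Definition smooth_fun_near (p : M) (f : M -> R) : Prop :=
  exists U : set M, [/\ open U, U p & forall u, atlas S u ->
    smooth_on (u @` (U `&` chart_dom u)) (fun x => f (chart_inv u x))].

Definition smooth_field_near (p : M) (X : field) : Prop :=
  exists U : set M, [/\ open U, U p & forall u, atlas S u ->
    smooth_on (u @` (U `&` chart_dom u)) (field_loc u X)].

Definition dfun (f : M -> R) (p : M) (v : 'rV[R]_n) : R :=
  'd (fun x => f (chart_inv (chart_at S p) x)) (chart_at S p p) v.

(* [X, Y]^k = X^i dY^k/du^i - Y^i dX^k/du^i *)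
Definition lie_bracket (X Y : field) (p : M) : 'rV[R]_n :=
  let u := chart_at S p in
  'd (field_loc u Y) (u p) (X p) - 'd (field_loc u X) (u p) (Y p).

(* The derivative [nabla X Y] at [p] is constrained for all fields that are
   smooth in some neighbourhood of [p], not only for globally smooth ones: the
   operator comes with its restrictions to open sets.  In particular
   [nabla] is local, and it applies to coordinate fields. *)
Definition linear_connection (nabla : field -> field -> field) : Prop :=
  forall (p : M) (f : M -> R) (X X' Y Y' : field),
    smooth_fun_near p f ->
    smooth_field_near p X -> smooth_field_near p X' ->
    smooth_field_near p Y -> smooth_field_near p Y' ->
    [/\ nabla (fun q => f q *: X q + X' q) Y p =
          f p *: nabla X Y p + nabla X' Y p,
        nabla X (fun q => Y q + Y' q) p = nabla X Y p + nabla X Y' p,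
        nabla X (fun q => f q *: Y q) p =
          f p *: nabla X Y p + dfun f p (X p) *: Y p &
        smooth_field_near p (nabla X Y)].

Definition torsion (nabla : field -> field -> field)
    (X Y : field) (p : M) : 'rV[R]_n :=
  nabla X Y p - nabla Y X p - lie_bracket X Y p.

Definition one_form (rho : M -> 'rV[R]_n -> R) : Prop :=
  (forall p (a : R) X Y, rho p (a *: X + Y) = a * rho p X + rho p Y) /\
  (forall u, atlas S u -> forall i : 'I_n, smooth_on (chart_img u)
     (fun x => rho (chart_inv u x) (coord_field u i (chart_inv u x)))).

Definition semi_symmetric_with (nabla : field -> field -> field)
    (rho : M -> 'rV[R]_n -> R) : Prop :=
  forall (p : M) (X Y : field),
    smooth_field_near p X -> smooth_field_near p Y ->
    torsion nabla X Y p = rho p (Y p) *: X p - rho p (X p) *: Y p.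

(* nabla_(d/du^i) d/du^j = Gamma_ij^k d/du^k *)
Definition conn_coef (nabla : field -> field -> field)
    (u : chart R n M) (p : M) (i j k : 'I_n) : R :=
  tcoord u p (nabla (coord_field u i) (coord_field u j) p) 0 k.

Definition smooth_curve (I : set R) (c : R -> M) : Prop :=
  (forall t, I t -> {for t, continuous c}) /\
  (forall u, atlas S u ->
     smooth_on (I `&` c @^-1` chart_dom u) (fun t => u (c t))).

Definition parallel_along (nabla : field -> field -> field)
    (I : set R) (c : R -> M) (V : R -> 'rV[R]_n) : Prop :=
  forall t u, I t -> atlas S u -> chart_dom u (c t) ->
    let x := fun s => u (c s) in
    let y := fun s => tcoord u (c s) (V s) in
    derivable y t 1 /\
    forall k : 'I_n,
      (derive1 y t) 0 k +
      \sum_(i < n) \sum_(j < n)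
         conn_coef nabla u (c t) i j k * (derive1 x t) 0 i * (y t) 0 j = 0.

(* [w] is the parallel transport of [v] along [c] from [c s] to [c t] *)
Definition parallel_transport (nabla : field -> field -> field)
    (c : R -> M) (s t : R) (v w : 'rV[R]_n) : Prop :=
  exists (I : set R) (V : R -> 'rV[R]_n),
    [/\ open_interval I, I s /\ I t, smooth_curve I c,
        parallel_along nabla I c V & V s = v /\ V t = w].

Definition compatible (F : M -> 'rV[R]_n -> R)
    (nabla : field -> field -> field) : Prop :=
  forall c s t v w,
    parallel_transport nabla c s t v w -> F (c t) w = F (c s) v.

(* F as a function of the induced coordinates (x, y) on TM *)
Definition F_loc (F : M -> 'rV[R]_n -> R) (u : chart R n M)
    (x y : 'rV[R]_n) : R :=
  F (chart_inv u x) (tvec u (chart_inv u x) y).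

Definition energy
    (F : M -> 'rV[R]_n -> R) (p : M) (v : 'rV[R]_n) : R := (F p v) ^+ 2 / 2.

(* The matrix of g_ij(v), in the linear coordinates y^i of T_pM. *)
Definition fund_mx (F : M -> 'rV[R]_n -> R) (p : M) (v : 'rV[R]_n) : 'M[R]_n :=
  \matrix_(i < n, j < n)
    'D_(unit_row R i) (fun w => 'D_(unit_row R j) (energy F p) w) v.

Definition fund (F : M -> 'rV[R]_n -> R) (p : M) (v X Y : 'rV[R]_n) : R :=
  \sum_(i < n) \sum_(j < n) fund_mx F p v i j * X 0 i * Y 0 j.

Record finsler_metric (F : M -> 'rV[R]_n -> R) : Prop :=
  FinslerMetric {
    finsler_ge0 : forall p v, 0 <= F p v;
    finsler_continuous : forall u, atlas S u ->
      forall z : 'rV[R]_n * 'rV[R]_n, chart_img u z.1 ->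
        {for z, continuous (fun z => F_loc F u z.1 z.2)};
    finsler_smooth : forall u, atlas S u ->
      smooth_on [set z : 'rV[R]_n * 'rV[R]_n | chart_img u z.1 /\ z.2 != 0]
        (fun z => F_loc F u z.1 z.2);
    finsler_homogeneous : forall p (t : R) v, 0 < t -> F p (t *: v) = t * F p v;
    finsler_eq0 : forall p v, F p v = 0 <-> v = 0;
    finsler_posdef : forall p v X, v != 0 -> X != 0 -> 0 < fund F p v X X }.

Record riemannian_metric (h : M -> 'rV[R]_n -> 'rV[R]_n -> R) : Prop :=
  RiemannianMetric {
    riem_linear : forall p (a : R) X Y Z,
      h p (a *: X + Y) Z = a * h p X Z + h p Y Z;
    riem_sym : forall p X Y, h p X Y = h p Y X;
    riem_posdef : forall p X, X != 0 -> 0 < h p X X;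
    riem_smooth : forall u, atlas S u -> forall i j : 'I_n,
      smooth_on (chart_img u) (fun x => h (chart_inv u x)
        (coord_field u i (chart_inv u x))
        (coord_field u j (chart_inv u x))) }.

Definition riemannian_finsler (F : M -> 'rV[R]_n -> R) : Prop :=
  exists2 h, riemannian_metric h & forall p v, F p v = Num.sqrt (h p v v).

Definition indicatrix
    (F : M -> 'rV[R]_n -> R) (p : M) : set 'rV[R]_n := [set v | F p v = 1].

Definition indicatrix_param
    (F : M -> 'rV[R]_n -> R) (p : M) (D : set 'rV[R]_n.-1)
    (sigma : 'rV[R]_n.-1 -> 'rV[R]_n) : Prop :=
  [/\ open D, smooth_on D sigma, {in D &, injective sigma},
      forall s, D s -> row_free ('J sigma s) &
      forall s, D s -> indicatrix F p (sigma s)].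

(* sqrt (det (g (d sigma/ds^a, d sigma/ds^b))); the rows of ['J sigma s] are
   the partial derivatives of [sigma]. *)
Definition indicatrix_density
    (F : M -> 'rV[R]_n -> R) (p : M) (sigma : 'rV[R]_n.-1 -> 'rV[R]_n)
    (s : 'rV[R]_n.-1) : R :=
  Num.sqrt (\det (\matrix_(a < n.-1, b < n.-1)
    fund F p (sigma s) (row a ('J sigma s)) (row b ('J sigma s)))).

(* The Riemannian volume measure of the hypersurface S_p of
   (T_pM \ {0}, g_ij), seen as a Borel measure on T_pM carried by S_p: in
   every local parametrization it has the usual density. These conditions
   determine it uniquely. *)
Definition indicatrix_volume (F : M -> 'rV[R]_n -> R) (p : M)
    (mu : {measure set (borel_rV R n) -> \bar R}) : Prop :=
  mu (~` indicatrix F p) = 0%E /\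
  forall D sigma, indicatrix_param F p D sigma ->
    forall A : set (borel_rV R n), measurable A ->
      mu (A `&` sigma @` D) =
      lebesgue_iint (fun s =>
        (\1_(D `&` sigma @^-1` A) s * indicatrix_density F p sigma s)%:E).

Definition averaged_metric
    (F : M -> 'rV[R]_n -> R) (gamma : M -> 'rV[R]_n -> 'rV[R]_n -> R) : Prop :=
  forall p, exists2 mu : {measure set (borel_rV R n) -> \bar R},
    indicatrix_volume F p mu &
    forall X Y, gamma p X Y = \int[mu]_(v in indicatrix F p) fund F p v X Y.

Definition metric_mx (h : M -> 'rV[R]_n -> 'rV[R]_n -> R)
    (u : chart R n M) (x : 'rV[R]_n) : 'M[R]_n :=
  \matrix_(i < n, j < n) h (chart_inv u x)
    (coord_field u i (chart_inv u x)) (coord_field u j (chart_inv u x)).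

Definition christoffel (h : M -> 'rV[R]_n -> 'rV[R]_n -> R)
    (u : chart R n M) (i j k : 'I_n) (x : 'rV[R]_n) : R :=
  let h_ a b := fun z => metric_mx h u z a b in
  2^-1 * \sum_(l < n) invmx (metric_mx h u x) k l *
    ('D_(unit_row R i) (h_ j l) x + 'D_(unit_row R j) (h_ i l) x
     - 'D_(unit_row R l) (h_ i j) x).

Definition geodesic (h : M -> 'rV[R]_n -> 'rV[R]_n -> R)
    (I : set R) (c : R -> M) : Prop :=
  smooth_curve I c /\
  forall t u, I t -> atlas S u -> chart_dom u (c t) ->
    let x := fun s => u (c s) in
    forall k : 'I_n,
      (derive1 (derive1 x) t) 0 k +
      \sum_(i < n) \sum_(j < n)
        christoffel h u i j k (x t) * (derive1 x t) 0 i * (derive1 x t) 0 j = 0.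

(* The image of the chart [u] is star-shaped about u(p) = 0 and the geodesic
   with initial velocity a^i d/du^i(p) is t |-> u^-1 (t a), that is,
   u^-1 (a) = exp_p (a^i d/du^i(p)). *)
Definition normal_coordinates (h : M -> 'rV[R]_n -> 'rV[R]_n -> R)
    (p : M) (u : chart R n M) : Prop :=
  [/\ atlas S u, chart_dom u p, u p = 0,
      forall a (t : R), chart_img u a -> 0 <= t <= 1 -> chart_img u (t *: a) &
      forall a : 'rV[R]_n,
        geodesic h [set t | chart_img u (t *: a)]
          (fun t => chart_inv u (t *: a))].

Definition orthonormal_frame (h : M -> 'rV[R]_n -> 'rV[R]_n -> R)
    (p : M) (u : chart R n M) : Prop :=
  forall i j : 'I_n,
    h p (coord_field u i p) (coord_field u j p) = (i == j)%:R.

(* From here on vectors of T_pM are given by their coordinates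
   [v^1, ..., v^n] in the chart [u]. *)

Definition dFdy (F : M -> 'rV[R]_n -> R) (u : chart R n M)
    (p : M) (i : 'I_n) (v : 'rV[R]_n) : R :=
  'D_(unit_row R i) (fun y => F_loc F u (u p) y) v.

Definition dFdx (F : M -> 'rV[R]_n -> R) (u : chart R n M)
    (p : M) (i : 'I_n) (v : 'rV[R]_n) : R :=
  'D_(unit_row R i) (fun x => F_loc F u x v) (u p).

Definition vertically_contact (F : M -> 'rV[R]_n -> R) (u : chart R n M)
    (p : M) (v : 'rV[R]_n) : Prop :=
  ~~ free [:: \row_(i < n) dFdy F u p i v; v].

Definition f_v (F : M -> 'rV[R]_n -> R) (u : chart R n M)
    (p : M) (i j : 'I_n) (v : 'rV[R]_n) : R :=
  v 0 i * dFdy F u p j v - v 0 j * dFdy F u p i v.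

Definition f_h (F : M -> 'rV[R]_n -> R) (u : chart R n M)
    (p : M) (i j : 'I_n) (v : 'rV[R]_n) : R :=
  v 0 i * dFdx F u p j v - v 0 j * dFdx F u p i v.

Definition metric_closed_ball (h : M -> 'rV[R]_n -> 'rV[R]_n -> R)
    (u : chart R n M) (p : M) (v : 'rV[R]_n) (eps : R) : set 'rV[R]_n :=
  [set w | Num.sqrt (h p (tvec u p (w - v)) (tvec u p (w - v))) <= eps].

End Geometry.

(* Main.v *)
Require Import Defs.
From HB Require Import structures.
From mathcomp Require Import all_boot all_order all_algebra.
From mathcomp Require Import all_classical all_reals all_analysis.
From mathcomp Require Import measurable_realfun ring lra.
Set Implicit Arguments.
Unset Strict Implicit.
Unset Printing Implicit Defensive.
Import Order.TTheory GRing.Theory Num.Theory.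
Import numFieldNormedType.Exports.
Local Open Scope classical_set_scope.
Local Open Scope ring_scope.

(** Once the connection coefficients at [p] are known, the formula is linear
    algebra; the substance is that normal coordinates determine them from [rho].

    A parallel transport of a compatible connection is a linear map between two
    tangent spaces that preserves [F]. It then preserves the energy, the second
    derivative of the energy, the volume of the indicatrix built from it, and
    therefore [gamma] ([averaged_metric_isometry]). So the connection is metric
    for [gamma]: at [p] the derivative of gamma_jk along u^i is
    Gamma_ij^k + Gamma_ik^j ([averaged_metric_derive]). In normal coordinates
    the rays through [p] are geodesics, which makes the symmetrized Christoffel
    symbols of [gamma] vanish at [p] ([christoffel_quadratic]). These facts and
    the torsion identity are linear equations in the coefficients, with the
    unique solution Gamma_ij^k = rho_j delta_ik - rho_k delta_ij
    ([conn_coef_center]).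

    On the other hand [F] is constant along a parallel field, and differentiating
    this along the i-th coordinate line gives
    dF/dx^i = sum_jk Gamma_ij^k y^j dF/dy^k ([dFdx_center]), that is,
    dF/dx^i = rho(y) dF/dy^i - y^i sum_k rho_k dF/dy^k. The last term cancels in
    the antisymmetrization, so f^h_ji(y) = rho(y) f_ji(y) ([f_h_center]). The
    quotients of the theorem are thus rho(w_l) = rho(v) - eps rho_l; their sum
    with weights v^l is (v~ - eps) rho(v), and the formula solves for rho_k.

    Two points carry most of the work. First, compatibility only speaks of
    parallel fields, so these have to be produced: along a line their
    components solve a linear differential equation, for which Picard iteration
    gives a fundamental matrix ([fundamental_matrix]), and the equation has to
    be transported to every other chart ([parallel_chart_change]). Second,
    [gamma] is the integral for some measure with the right density in every
    parametrization of the indicatrix. Isometry invariance needs this measure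
    to be unique ([indicatrix_volume_unique]), which holds because finitely
    many radial projections of affine hyperplanes parametrize the whole
    indicatrix. The symmetry of second derivatives ([derive_comm]) enters
    twice: coordinate fields commute, and the fundamental tensor is symmetric.
    *)

(** * Germs, functions of class C^k, symmetry of second derivatives *)

Section Germs.
Context {R : realType} {V W : normedModType R}.

(** A first-order expansion of [f] at [x] is also one of [g]: this makes
    differentials depend on germs only. *)
Lemma near_eq_diff_locally (f g : V -> W) (x : V) (d : {linear V -> W}) :
  (\forall z \near x, f z = g z) ->
  f \o shift x = cst (f x) + d +o_ 0 id ->
  g \o shift x = cst (g x) + d +o_ 0 id.
Proof.
move=> fg fd; apply/eqaddoP => e e0.
have fgx := nbhs_singleton fg.
have fgs : \forall h \near (0 : V), f (h + x) = g (h + x).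
  have : {for 0, continuous (fun h : V => h + x)}.
    by apply: cvgD; [exact: cvg_id|exact: cvg_cst].
  by move=> c; apply: (c [set z | f z = g z]); rewrite add0r.
move/eqaddoP : fd => /(_ e e0) fd; apply: filterS2 fgs fd => h fgh.
by rewrite !fctE /= -fgh -fgx.
Qed.

Lemma near_eq_differentiable (f g : V -> W) (x : V) :
  (\forall z \near x, f z = g z) -> differentiable f x -> differentiable g x.
Proof.
move=> fg df; have fd := near_eq_diff_locally fg (diff_locally df).
apply/diff_locallyP; have dc : continuous ('d f x) by exact: diff_continuous.
by rewrite (diff_unique dc fd).
Qed.

Lemma near_eq_diff (f g : V -> W) (x : V) :
  (\forall z \near x, f z = g z) -> differentiable f x ->
  'd g x = 'd f x :> (V -> W).
Proof.
move=> fg df; have fd := near_eq_diff_locally fg (diff_locally df).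
by apply: diff_unique fd; exact: diff_continuous.
Qed.

End Germs.

Section LinearFiniteDim.
Context {R : realType}.

Lemma row_sum_unit n (x : 'rV[R]_n) : x = \sum_(j < n) x 0 j *: unit_row R j.
Proof. exact: row_sum_delta. Qed.

Lemma differentiable_sumE (V W : normedModType R) n (f : 'I_n -> V -> W) (x : V) :
  (forall j, differentiable (f j) x) ->
  differentiable (fun z => \sum_(j < n) f j z) x.
Proof.
move=> df; have := differentiable_sum df; congr (differentiable _ _).
by apply/funext => z; rewrite fct_sumE.
Qed.

Lemma linear_rV_continuous n (W : normedModType R) (L : {linear 'rV[R]_n -> W}) :
  continuous L.
Proof.
have -> : (L : _ -> _) = (fun x : 'rV[R]_n => \sum_(j < n) x 0 j *: L (unit_row R j)).
  apply/funext => x; rewrite {1}(row_sum_unit x) linear_sum.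
  by apply: eq_bigr => j _; rewrite linearZ.
move=> x; apply: differentiable_continuous; apply: differentiable_sumE => j.
exact/differentiableZl/differentiable_coord.
Qed.

Lemma differentiable_rowP (V : normedModType R) n (f : V -> 'rV[R]_n) (x : V) :
  (forall j, differentiable (fun z => f z 0 j) x) -> differentiable f x.
Proof.
move=> df.
have -> : f = (fun z => \sum_(j < n) f z 0 j *: unit_row R j).
  by apply/funext => z; rewrite -row_sum_unit.
by apply: differentiable_sumE => j; exact: differentiableZl.
Qed.

Definition coordL n (j : 'I_n) (y : 'rV[R]_n) : R := y 0 j.
Fact coordL_linear n (j : 'I_n) : linear (@coordL n j).
Proof. by move=> a y z; rewrite /coordL !mxE. Qed.
HB.instance Definition _ n (j : 'I_n) :=
  GRing.isLinear.Build R 'rV[R]_n R _ (@coordL n j) (coordL_linear j).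

Lemma diff_linear_comp (V W W' : normedModType R) (L : {linear W -> W'})
    (f : V -> W) (x : V) : continuous L -> differentiable f x ->
  'd (fun z => L (f z)) x = (fun h => L ('d f x h)) :> (V -> W').
Proof.
move=> Lc df; have dL : differentiable L (f x) by exact: linear_differentiable.
by rewrite (_ : (fun z => _) = L \o f) // diff_comp // diff_lin.
Qed.

Lemma differentiable_linear_comp (V W W' : normedModType R) (L : {linear W -> W'})
    (f : V -> W) (x : V) : continuous L -> differentiable f x ->
  differentiable (fun z => L (f z)) x.
Proof.
move=> Lc df; apply: (@differentiable_comp _ _ _ _ f L) => //.
exact: linear_differentiable.
Qed.

End LinearFiniteDim.

Section CkCalculus.
Context {R : realType}.
Implicit Types V W : normedModType R.

Lemma Ck_on_eq V W k (U : set V) (f g : V -> W) : open U ->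
  (forall x, U x -> f x = g x) -> Ck_on k U f -> Ck_on k U g.
Proof.
move=> oU; 
have fgn (f' g' : V -> W) x : (forall x, U x -> f' x = g' x) -> U x ->
    \forall z \near x, f' z = g' z.
  by move=> fg Ux; near=> z; apply/fg; near: z; exact: open_nbhs_nbhs.
elim: k f g => [|k IH] f g fg /=.
  move=> cf x Ux; suff : g z @[z --> x] --> f x by rewrite fg.
  by apply: cvg_trans (cf _ Ux); apply: near_eq_cvg; exact: fgn.
move=> [df dk]; split=> [x Ux|v].
  by apply: near_eq_differentiable (fgn _ _ _ fg Ux) _; exact: df.
apply: IH (dk v) => x Ux; apply: near_eq_derive; exact: fgn.
Unshelve. all: by end_near. Qed.

Lemma Ck_on_sub V W k (U U' : set V) (f : V -> W) :
  U' `<=` U -> Ck_on k U f -> Ck_on k U' f.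
Proof.
move=> sU; elim: k f => [|k IH] f /= => [cf x /sU|[df dk]]; first exact: cf.
by split=> [x /sU|v]; [exact: df|exact/IH/dk].
Qed.

Lemma Ck_on_pred V W k (U : set V) (f : V -> W) : Ck_on k.+1 U f -> Ck_on k U f.
Proof.
elim: k f => [|k IH] f; last by move=> [df dk]; split => // v; exact/IH/dk.
by move=> [df _] x Ux; exact/differentiable_continuous/df.
Qed.

Lemma Ck_on_linear_comp V W W' k (U : set V) (L : {linear W -> W'}) (f : V -> W) :
  open U -> continuous L -> Ck_on k U f -> Ck_on k U (fun x => L (f x)).
Proof.
move=> oU Lc; elim: k f => [|k IH] f /=.
  by move=> cf x Ux; apply: continuous_comp; [exact: cf|exact: Lc].
move=> [df dk]; split=> [x Ux|v].
  exact/differentiable_linear_comp/df.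
apply: Ck_on_eq oU _ (IH _ (dk v)) => x Ux.
have dfx := df _ Ux; have dLfx := differentiable_linear_comp Lc dfx.
by rewrite (deriveE _ dfx) [RHS](deriveE _ dLfx) diff_linear_comp.
Qed.

(** An affine substitution only changes the direction of each derivative into
    its image, so that no product rule enters. *)
Lemma Ck_on_affine_comp V W W' k (U : set V) (O : set W) (L : {linear V -> W})
    (b : W) (f : W -> W') : open U -> continuous L ->
  (forall x, U x -> O (L x + b)) ->
  Ck_on k O f -> Ck_on k U (fun x => f (L x + b)).
Proof.
move=> oU Lc UO; have Ld x : differentiable (fun x => L x + b) x.
  by apply: differentiableD => //; exact: linear_differentiable.
elim: k f => [|k IH] f /=.
  move=> cf x Ux; apply: (@continuous_comp _ _ _ (fun x => L x + b) f).
    exact: differentiable_continuous.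
  exact/cf/UO.
move=> [df dk]; split=> [x Ux|v].
  by apply: (@differentiable_comp _ _ _ _ (fun x => L x + b) f) => //; exact/df/UO.
apply: Ck_on_eq oU _ (IH _ (dk (L v))) => x Ux.
have dfx := df _ (UO _ Ux); have dcomp := differentiable_comp (Ld x) dfx.
rewrite (deriveE _ dfx) [RHS](deriveE _ dcomp) (diff_comp (Ld x) dfx) /=.
congr ('d f _ _); have dL : differentiable L x by exact: linear_differentiable.
by rewrite (diffD dL (differentiable_cst _ _)) diff_cst /= addr0 diff_lin.
Qed.

Lemma Ck_on_cst V W k (U : set V) (a : W) : Ck_on k U (fun=> a).
Proof.
elim: k a => [|k IH] a /=; first by move=> x _; exact: cst_continuous.
split=> [x _|v]; first exact: differentiable_cst.
rewrite (_ : 'D_v _ = fun=> 0); first exact: IH.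
by apply/funext => x; rewrite derive_cst.
Qed.

Lemma Ck_on_linear V W k (U : set V) (L : {linear V -> W}) :
  continuous L -> Ck_on k U L.
Proof.
move=> Lc; case: k => [|k] /=; first by move=> x _; exact: Lc.
split=> [x _|v]; first exact: linear_differentiable.
rewrite (_ : 'D_v _ = fun=> L v); first exact: Ck_on_cst.
apply/funext => x; rewrite deriveE ?diff_lin //; exact: linear_differentiable.
Qed.

Lemma Ck_on_add V W k (U : set V) (f g : V -> W) : open U ->
  Ck_on k U f -> Ck_on k U g -> Ck_on k U (fun x => f x + g x).
Proof.
move=> oU; elim: k f g => [|k IH] f g /=.
  by move=> cf cg x Ux; apply: continuousD; [exact: cf|exact: cg].
move=> [df dkf] [dg dkg]; split=> [x Ux|v].
  by apply: differentiableD; [exact: df|exact: dg].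
apply: Ck_on_eq oU _ (IH _ _ (dkf v) (dkg v)) => x Ux.
by rewrite [RHS]deriveD //; apply: diff_derivable; [exact: df|exact: dg].
Qed.

Lemma Ck_on_sum V W k (U : set V) n (f : 'I_n -> V -> W) : open U ->
  (forall j, Ck_on k U (f j)) -> Ck_on k U (fun x => \sum_(j < n) f j x).
Proof.
move=> oU fk; elim: n f fk => [|n IH] f fk.
  rewrite (_ : (fun x => _) = fun=> 0); first exact: Ck_on_cst.
  by apply/funext => x; rewrite big_ord0.
rewrite (_ : (fun x => _) = fun x => f ord0 x + \sum_(j < n) f (lift ord0 j) x).
  by apply: Ck_on_add => //; exact: IH.
by apply/funext => x; rewrite big_ord_recl.
Qed.

Lemma Ck_on_mul V k (U : set V) (f g : V -> R) : open U ->
  Ck_on k U f -> Ck_on k U g -> Ck_on k U (fun x => f x * g x).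
Proof.
move=> oU; elim: k f g => [|k IH] f g fk gk.
  by move=> x Ux; apply: continuousM; [exact: fk|exact: gk].
have [[df dkf] [dg dkg]] := (fk, gk).
split=> [x Ux|v].
  by apply: differentiableM; [exact: df|exact: dg].
apply: (@Ck_on_eq _ _ _ _ (fun x => f x * 'D_v g x + g x * 'D_v f x)) => // [x Ux|].
  by rewrite [RHS]deriveM //; apply: diff_derivable; [exact: df|exact: dg].
apply: Ck_on_add => //; apply: IH; [exact: Ck_on_pred|exact: dkg|exact: Ck_on_pred|exact: dkf].
Qed.

Lemma Ck_on_inv V k (U : set V) (f : V -> R) : open U ->
  (forall x, U x -> f x != 0) -> Ck_on k U f -> Ck_on k U (fun x => (f x)^-1).
Proof.
move=> oU f0; elim: k => [|k IH] fk.
  by move=> x Ux; apply: continuousV; [exact: f0|exact: fk].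
have df := fk.1; have dkf v : Ck_on k U ('D_v f) := fk.2 v; have fVk := IH (Ck_on_pred fk).
split=> [x Ux|v]; first by apply: differentiableV; [exact: df|exact: f0].
apply: (@Ck_on_eq _ _ _ _ (fun x => (f x)^-1 * (f x)^-1 * (- 'D_v f x))) => // [x Ux|].
  rewrite [RHS]deriveV; [|exact: f0|by apply: diff_derivable; exact: df].
  by rewrite mulrN -expr2 exprVn -mulNr.
apply: Ck_on_mul => //; first exact: Ck_on_mul.
by apply: (@Ck_on_linear_comp _ _ _ _ _ -%R ('D_v f)) => // x; exact: opp_continuous.
Qed.

Lemma Ck_on_coord V k (U : set V) n (f : V -> 'rV[R]_n) (j : 'I_n) : open U ->
  Ck_on k U f -> Ck_on k U (fun x => f x 0 j).
Proof.
move=> oU fk; apply: (@Ck_on_linear_comp _ _ _ _ _ (@coordL R n j)) => //.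
exact: linear_rV_continuous.
Qed.

Lemma Ck_on_row V k (U : set V) n (f : V -> 'rV[R]_n) : open U ->
  (forall j, Ck_on k U (fun x => f x 0 j)) -> Ck_on k U f.
Proof.
move=> oU fk.
rewrite (_ : f = fun x => \sum_(j < n) f x 0 j *: unit_row R j); last first.
  by apply/funext => x; rewrite -row_sum_unit.
apply: Ck_on_sum => // j.
pose L (t : R) := t *: unit_row R j : 'rV[R]_n.
have Ll : linear L by move=> a b c; rewrite /L scalerDl scalerA.
pose LL : {linear R -> 'rV[R]_n} := HB.pack L (GRing.isLinear.Build _ _ _ _ L Ll).
apply: (@Ck_on_linear_comp _ _ _ _ _ LL) => // t.
by apply: cvgZr_tmp; exact: cvg_id.
Qed.

(** The derivative of the composite is a sum of products of an entry of [D_v f]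
    with a partial derivative of [g] taken at [f x]; the latter is a composite of
    lower class, to which induction applies. *)
Lemma Ck_on_comp_scalar V k (U : set V) m (O : set 'rV[R]_m)
    (f : V -> 'rV[R]_m) (g : 'rV[R]_m -> R) : open U ->
  (forall x, U x -> O (f x)) -> Ck_on k U f -> Ck_on k O g ->
  Ck_on k U (fun x => g (f x)).
Proof.
move=> oU UO; elim: k g => [|k IH] g fk gk.
  by move=> x Ux; apply: continuous_comp; [exact: fk|exact/gk/UO].
have df := fk.1; have dkf v : Ck_on k U ('D_v f) := fk.2 v.
have dg := gk.1; have dkg v : Ck_on k O ('D_v g) := gk.2 v.
split=> [x Ux|v].
  by apply: (@differentiable_comp _ _ _ _ f g); [exact: df|exact/dg/UO].
apply: (@Ck_on_eq _ _ _ _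
  (fun x => \sum_(j < m) ('D_v f x) 0 j * 'D_(unit_row R j) g (f x))) => // [x Ux|].
  have dfx := df _ Ux; have dgx := dg _ (UO _ Ux).
  have dgf := differentiable_comp dfx dgx.
  rewrite [RHS](deriveE _ dgf) (diff_comp dfx dgx) /= -(deriveE _ dfx).
  rewrite [X in _ = 'd _ _ X]row_sum_unit linear_sum.
  by apply: eq_bigr => j _; rewrite linearZ /= (deriveE _ dgx).
apply: Ck_on_sum => // j; apply: Ck_on_mul => //.
  exact: Ck_on_coord.
exact: (IH ('D_(unit_row R j) g) (Ck_on_pred fk) (dkg _)).
Qed.

Lemma Ck_on_comp V k (U : set V) m n (O : set 'rV[R]_m)
    (f : V -> 'rV[R]_m) (g : 'rV[R]_m -> 'rV[R]_n) : open U -> open O ->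
  (forall x, U x -> O (f x)) -> Ck_on k U f -> Ck_on k O g ->
  Ck_on k U (fun x => g (f x)).
Proof.
move=> oU oO UO fk gk; apply: Ck_on_row => // j.
by apply: (@Ck_on_comp_scalar _ _ _ _ O f (fun z => g z 0 j)) => //; exact: Ck_on_coord.
Qed.

End CkCalculus.

Section Curves.
Context {R : realType}.

Lemma is_derive_comp_curve (V W : normedModType R) (g : V -> W) (c : R -> V)
    (t : R) (c' : V) :
  is_derive t 1 c c' -> differentiable g (c t) ->
  is_derive t 1 (fun s => g (c s)) ('d g (c t) c').
Proof.
move=> [dc cE] dg; have dct : differentiable c t by exact/derivable1_diffP.
have dgc : differentiable (g \o c) t by exact: differentiable_comp.
apply: DeriveDef; first exact/(derivable1_diffP _ _).2.
by rewrite (deriveE _ dgc) (diff_comp dct dg) /= -cE (deriveE _ dct).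
Qed.

Lemma is_derive_line (V W : normedModType R) (f : V -> W) (a v : V) (t : R) :
  differentiable f (a + t *: v) ->
  is_derive t 1 (fun s => f (a + s *: v)) ('D_v f (a + t *: v)).
Proof.
move=> df; rewrite (deriveE _ df).
apply: (@is_derive_comp_curve _ _ f (fun s => a + s *: v)) => //.
have dl : is_diff t (fun s : R => a + s *: v) (0 + *:%R^~ v) by apply: is_diffD.
apply: DeriveDef; first by apply: diff_derivable; exact: ex_diff.
rewrite deriveE; last exact: ex_diff.
by rewrite (@diff_val _ _ _ _ _ _ _ dl) fctE /= scale1r add0r.
Qed.

Lemma is_derive_rowP n (c : R -> 'rV[R]_n) (c' : 'rV[R]_n) (t : R) :
  (forall j, is_derive t 1 (fun s => c s 0 j) (c' 0 j)) <-> is_derive t 1 c c'.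
Proof.
split=> [dc|dc j].
  have dct : differentiable c t.
    apply: differentiable_rowP => j; apply/derivable1_diffP.
    by have [] := dc j.
  apply: DeriveDef; first exact/derivable1_diffP.
  apply/rowP => j; have [_ <-] := dc j.
  have dcj : differentiable (fun s => coordL j (c s)) t.
    by apply: differentiable_linear_comp => //; exact: linear_rV_continuous.
  rewrite (deriveE _ dct) (deriveE _ dcj) diff_linear_comp //.
  exact: linear_rV_continuous.
have := @is_derive_comp_curve _ _ (@coordL R n j) c t c' dc.
have Lc := @linear_rV_continuous R n _ (@coordL R n j).
by rewrite diff_lin //; apply; exact: linear_differentiable.
Qed.

Lemma mean_value_segment (phi dphi : R -> R) (h : R) : 0 < h ->
  (forall s, 0 <= s <= h -> is_derive s 1 phi (dphi s)) ->
  exists2 s, 0 <= s <= h & phi h - phi 0 = dphi s * h.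
Proof.
move=> h0 dphiE.
have oc (s : R) : s \in `]0, h[ -> 0 <= s <= h.
  by rewrite in_itv /= => /andP[/ltW -> /ltW ->].
have [|s /oc sh E] := @MVT R phi dphi 0 h h0 (fun s sh => dphiE s (oc s sh)).
  apply: derivable_within_continuous => s; rewrite in_itv /= => sh.
  by have [] := dphiE _ sh.
by exists s => //; rewrite E subr0.
Qed.

(** The mean value theorem, applied first along [u] and then along [v]. The left
    side is symmetric in [u] and [v], which is what makes it useful. *)
Lemma second_difference (V : normedModType R) (U : set V) (f : V -> R)
    (x u v : V) (h : R) : 0 < h -> Ck_on 2 U f ->
  (forall s t, 0 <= s <= h -> 0 <= t <= h -> U (x + s *: u + t *: v)) ->
  exists s t, [/\ 0 <= s <= h, 0 <= t <= h &
    f (x + h *: u + h *: v) - f (x + h *: u) - f (x + h *: v) + f x =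
    h * h * 'D_v ('D_u f) (x + s *: u + t *: v)].
Proof.
move=> h0 f2 Ux; have df := f2.1; have dDf := (f2.2 u).1.
have U0 s : 0 <= s <= h -> U (x + s *: u).
  by move=> sh; have := Ux s 0 sh; rewrite scale0r addr0; apply; rewrite lexx ltW.
have Uh s : 0 <= s <= h -> U (x + h *: v + s *: u).
  by move=> sh; rewrite addrAC; apply: Ux => //; rewrite lexx ltW.
pose phi s := f (x + h *: v + s *: u) - f (x + s *: u).
pose dphi s := 'D_u f (x + h *: v + s *: u) - 'D_u f (x + s *: u).
have dphiE s : 0 <= s <= h -> is_derive s 1 phi (dphi s).
  move=> sh; apply: is_deriveB; apply: is_derive_line; apply: df; [exact: Uh|exact: U0].
have [s sh phiE] := mean_value_segment h0 dphiE.
pose psi t := 'D_u f (x + s *: u + t *: v).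
pose dpsi t := 'D_v ('D_u f) (x + s *: u + t *: v).
have dpsiE t : 0 <= t <= h -> is_derive t 1 psi (dpsi t).
  by move=> th; apply: is_derive_line; apply: dDf; exact: Ux.
have [t th psiE] := mean_value_segment h0 dpsiE.
exists s, t; split => //.
rewrite -mulrA [X in h * X]mulrC -/(dpsi t) -psiE.
have -> : psi h - psi 0 = dphi s.
  by rewrite /psi /dphi scale0r addr0 [x + s *: u + h *: v]addrAC.
rewrite mulrC -phiE /phi !scale0r !addr0.
by rewrite opprB [RHS]addrA [LHS]addrAC [x + h *: v + h *: u]addrAC.
Qed.

Lemma scaled_eq (A A' B C D h P Q : R) : 0 < h -> A = A' ->
  A - B - C + D = h * h * P -> A' - C - B + D = h * h * Q -> P = Q.
Proof.
move=> h0 <- E1 E2; apply: (@mulfI _ (h * h)); first by rewrite mulf_neq0 // gt_eqF.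
by rewrite -E1 -E2 [A - C - B]addrAC.
Qed.

Lemma half_close (a b c e : R) : `|a - c| < e / 2 -> `|b - c| < e / 2 -> `|a - b| <= e.
Proof.
move=> ac bc; have -> : a - b = (a - c) + (c - b) by rewrite addrA subrK.
by rewrite (le_trans (ler_normD _ _)) // [e]splitr lerD // ltW // distrC.
Qed.

(** Both mixed derivatives, each taken at some point near [x], are the same second
    difference divided by [h * h]; their continuity at [x] does the rest. *)
Lemma derive_comm (V : normedModType R) (U : set V) (f : V -> R) (x u v : V) :
  open U -> U x -> Ck_on 2 U f -> 'D_u ('D_v f) x = 'D_v ('D_u f) x.
Proof.
move=> oU Ux f2; apply/eqP; rewrite -subr_eq0 -normr_eq0; apply/eqP.
apply/eqP; rewrite eq_le normr_ge0 andbT; apply/ler_addgt0Pl => e e0; rewrite addr0.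
pose d u v z := 'D_v ('D_u f) z.
have near_d u' v' : \forall z \near x, U z /\ `|d u' v' x - d u' v' z| < e / 2.
  apply: filterI; first exact: open_nbhs_nbhs.
  by have /cvgrPdist_lt := (f2.2 u').2 v' x Ux; apply; rewrite divr_gt0.
have [r /= r0 rP] := (nbhs_normP _ _).1 (filterI (near_d u v) (near_d v u)).
pose h := r / (2 * (`|u| + `|v| + 1)).
have h0 : 0 < h by rewrite divr_gt0 // mulr_gt0 // ltr_wpDl // addr_ge0.
have hr s t : 0 <= s <= h -> 0 <= t <= h -> `|x - (x + s *: u + t *: v)| < r.
  move=> /andP[s0 sh] /andP[t0 th].
  rewrite -addrA opprD addNKr normrN (le_lt_trans (ler_normD _ _)) // !normrZ !ger0_norm //.
  have : h * (`|u| + `|v|) < r.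
    rewrite /h mulrAC ltr_pdivrMr; last by rewrite mulr_gt0 // ltr_wpDl // addr_ge0.
    rewrite ltr_pM2l //; have := normr_ge0 u; have := normr_ge0 v; lra.
  apply: le_lt_trans; rewrite mulrDr lerD // ler_wpM2r //.
have hr' s t : 0 <= s <= h -> 0 <= t <= h -> `|x - (x + s *: v + t *: u)| < r.
  by move=> sh th; rewrite addrAC; exact: hr.
have [s [t [sh th E1]]] := @second_difference _ U f x u v h h0 f2
  (fun s t sh th => (rP _ (hr s t sh th)).1.1).
have [s' [t' [sh' th' E2]]] := @second_difference _ U f x v u h h0 f2
  (fun s t sh th => (rP _ (hr' s t sh th)).1.1).
have E : d u v (x + s *: u + t *: v) = d v u (x + s' *: v + t' *: u).
  exact: (scaled_eq h0 (congr1 f (addrAC _ _ _)) E1 E2).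
have H1 := (rP _ (hr s t sh th)).1.2; have H2 := (rP _ (hr' s' t' sh' th')).2.2.
by apply: half_close H2 _; rewrite /= -E.
Qed.

Lemma derive_comm_row (V : normedModType R) (U : set V) n (f : V -> 'rV[R]_n) (x u v : V) :
  open U -> U x -> Ck_on 2 U f -> 'D_u ('D_v f) x = 'D_v ('D_u f) x.
Proof.
move=> oU Ux f2; apply/rowP => j.
have coordD (g : V -> 'rV[R]_n) z w : differentiable g z ->
    ('D_w g z) 0 j = 'D_w (fun z => g z 0 j) z.
  move=> dg; have dgj : differentiable (fun s => coordL j (g s)) z.
    by apply: differentiable_linear_comp => //; exact: linear_rV_continuous.
  rewrite (deriveE _ dg) (deriveE _ dgj) diff_linear_comp //.
  exact: linear_rV_continuous.
have coordDD w w' : ('D_w ('D_w' f) x) 0 j = 'D_w ('D_w' (fun z => f z 0 j)) x.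
  rewrite coordD; last exact: (f2.2 w').1.
  apply: near_eq_derive; near=> z; apply: coordD; apply: f2.1.
  by near: z; exact: open_nbhs_nbhs.
apply: etrans (coordDD u v) _; apply: etrans _ (esym (coordDD v u)).
exact: derive_comm oU Ux (Ck_on_coord j oU f2).
Unshelve. all: by end_near. Qed.

End Curves.

(** * Linear differential equations *)

Section LinearODE.
Context {R : realType}.

Lemma mx_entry_le_norm m n (A : 'M[R]_(m, n)) i j : `|A i j| <= `|A|.
Proof.
rewrite (_ : `|A| = mx_norm A) // mx_normrE.
exact: (@le_bigmax _ _ _ 0 (fun ij : 'I_m * 'I_n => `|A ij.1 ij.2|) (i, j)).
Qed.

(** The lower end [-2] only has to lie to the left of the interval [-1, 1] where
    differential equations will be solved. *)
Lemma exists_primitive (g : R -> R) : continuous g ->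
  exists G : R -> R, forall t : R, -2 < t < 2 -> is_derive t 1 G (g t).
Proof.
move=> cg; exists (fun t => (\int[lebesgue_measure]_(s in `[-2, t]) g s)%R).
move=> t /andP[t1 t2].
have ig : lebesgue_measure.-integrable `[-2, 2] (EFin \o g).
  apply: continuous_compact_integrable; first exact: segment_compact.
  exact: continuous_subspaceT.
have [dG GE] := continuous_FTC1_closed t2 ig t1 (cg t).
split; [exact: dG|exact: etrans (esym (derive1E _ _)) GE].
Qed.

Definition clamp (d t : R) : R := Num.max (- d) (Num.min d t).

Lemma clamp_continuous d : continuous (clamp d).
Proof.
move=> t; apply: (@continuous_max _ _ (cst (- d)) (fun t => Num.min d t)).
  exact: cst_continuous.
by apply: (@continuous_min _ _ (cst d) id); [exact: cst_continuous|].
Qed.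

Lemma clamp_id d t : `|t| < d -> clamp d t = t.
Proof.
by rewrite ltr_norml => /andP[t1 t2]; rewrite /clamp (min_idPr (ltW t2)) (max_idPr (ltW t1)).
Qed.

Lemma clamp_le d t : 0 <= d -> `|clamp d t| <= d.
Proof.
move=> d0; rewrite /clamp ler_norml; apply/andP; split; first by rewrite le_max lexx.
by rewrite ge_max ge_min lexx /=; rewrite (le_trans _ d0) // oppr_le0.
Qed.

(** The primitive vanishing at [0], frozen outside [-d, d]: the truncation makes
    it a Lipschitz operator for the supremum norm over the whole line. Continuity
    of [g] is asked inside the existential so that a choice of [P] is a total
    operator on functions. *)
Lemma clamped_primitive (d : R) : 0 < d <= 1 -> forall g : R -> R, exists P : R -> R,
  continuous g -> [/\ continuous P, P 0 = 0,
    forall t : R, `|t| < d -> is_derive t 1 P (g t) &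
    exists2 G : R -> R, (forall t : R, -2 < t < 2 -> is_derive t 1 G (g t)) &
               forall t, P t = G (clamp d t) - G 0].
Proof.
move=> /andP[d0 d1] g; have [cg|ncg] := pselect (continuous g); last first.
  by exists (fun=> 0) => /ncg.
have [G dG] := exists_primitive cg.
have cl t : -2 < clamp d t < 2.
  by have := clamp_le t (ltW d0); rewrite -ltr_norml => /le_lt_trans; apply; lra.
exists (fun t => G (clamp d t) - G 0) => _; split.
- move=> t; apply: continuousB; last exact: cst_continuous.
  apply: (@continuous_comp _ _ _ (clamp d) G); first exact: clamp_continuous.
  by apply/differentiable_continuous/derivable1_diffP; have [] := dG _ (cl t).
- by rewrite clamp_id ?normr0 // subrr.
- move=> t td; rewrite -[g t]subr0; apply: is_deriveB.
  have dGt : is_derive t 1 G (g t) by apply: dG; rewrite -(clamp_id td).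
  apply: near_eq_is_derive dGt; near=> z; rewrite clamp_id //.
  by near: z; apply: (@cvgr_norm_lt _ _ _ (nbhs t) _ id t) => //; exact: cvg_id.
- by exists G.
Unshelve. all: by end_near. Qed.

(** The mean value theorem for [G - H] between [0] and the clamped point. *)
Lemma clamped_primitive_lipschitz (d m : R) (g h G H : R -> R) : 0 < d <= 1 ->
  (forall t : R, -2 < t < 2 -> is_derive t 1 G (g t)) ->
  (forall t : R, -2 < t < 2 -> is_derive t 1 H (h t)) ->
  (forall t : R, `|g t - h t| <= m) ->
  forall t, `|(G (clamp d t) - G 0) - (H (clamp d t) - H 0)| <= d * m.
Proof.
move=> /andP[d0 d1] dG dH ghm t; set c := clamp d t.
have cd : `|c| <= d by exact/clamp_le/ltW.
have m0 : 0 <= m := le_trans (normr_ge0 _) (ghm 0).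
have dK (s : R) : -2 < s < 2 -> is_derive s 1 (G - H) (g s - h s).
  by move=> s2; apply: is_deriveB; [exact: dG|exact: dH].
have MV (a b : R) : a < b -> -2 < a -> b < 2 -> exists s : R,
    (G - H) b - (G - H) a = (g s - h s) * (b - a).
  move=> ab a2 b2.
  have in2 (s : R) : a <= s <= b -> -2 < s < 2.
    by move=> /andP[? ?]; apply/andP; split; lra.
  have cK : {within `[a, b], continuous (G - H)}.
    apply: derivable_within_continuous => s; rewrite in_itv /= => /in2 s2.
    by have [] := dK _ s2.
  have dKab s : s \in `]a, b[ -> is_derive s 1 (G - H) (g s - h s).
    by rewrite in_itv /= => /andP[/ltW sa /ltW sb]; apply/dK/in2/andP.
  by have [s _ E] := MVT ab dKab cK; exists s.
have KE : (G c - G 0) - (H c - H 0) = (G - H) c - (G - H) 0.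
  by rewrite /= !fctE; lra.
have c2 : -2 < c < 2 by rewrite -ltr_norml (le_lt_trans cd) //; lra.
have /andP[c2l c2r] := c2.
have lt02 : 0 < 2 :> R by [].
have ltN20 : -2 < 0 :> R by rewrite oppr_lt0.
rewrite KE; have [c0|c0|->] := ltgtP c 0; last by rewrite subrr normr0 mulr_ge0 // ltW.
- have [s E] := MV c 0 c0 c2l lt02.
  rewrite -opprB normrN E normrM sub0r normrN mulrC; exact: ler_pM.
- have [s E] := MV 0 c c0 ltN20 c2r.
  rewrite E normrM subr0 mulrC; exact: ler_pM.
Qed.

End LinearODE.

Section Picard.
Context {R : realType} {n : nat}.
Variables (B : R -> 'M[R]_n) (K d : R) (v : 'rV[R]_n).
Hypothesis Bc : forall i j, continuous (fun s => B s i j).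
Hypothesis BK : forall s i j, `|B s i j| <= K.
Hypothesis d01 : 0 < d <= 1.
Hypothesis dK : d * (n%:R * K) <= 2^-1.

Let continuous_entries (y : R -> 'rV[R]_n) := forall j, continuous (fun s => y s 0 j).

Let field (y : R -> 'rV[R]_n) (j : 'I_n) (s : R) := (y s *m B s) 0 j.

Let field_continuous (y : R -> 'rV[R]_n) (j : 'I_n) : continuous_entries y -> continuous (field y j).
Proof.
move=> yc; rewrite (_ : field y j = fun s => \sum_(i < n) y s 0 i * B s i j); last first.
  by apply/funext => s; rewrite /field mxE.
move=> s; apply: (@Ck_on_sum R R R 0 setT n (fun i s => y s 0 i * B s i j)) => //.
  exact: openT.
by move=> i t _; apply: continuousM; [exact: yc|exact: Bc].
Qed.

Let field_lip (y z : R -> 'rV[R]_n) (j : 'I_n) (m : R) : (forall s i, `|y s 0 i - z s 0 i| <= m) ->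
  forall s, `|field y j s - field z j s| <= n%:R * K * m.
Proof.
move=> yz s; rewrite /field !mxE -sumrB (le_trans (ler_norm_sum _ _ _)) //.
rewrite (le_trans (ler_sum _ (_ : forall i, true -> _ <= K * m))) //.
  move=> i _; rewrite -mulrBl normrM mulrC ler_pM //; exact: yz.
by rewrite sumr_const card_ord -mulrA mulr_natl.
Qed.

Let primitive_spec (g P : R -> R) := continuous g ->
  [/\ continuous P, P 0 = 0,
    forall t : R, `|t| < d -> is_derive t 1 P (g t) &
    exists2 G : R -> R, (forall t : R, -2 < t < 2 -> is_derive t 1 G (g t)) &
               forall t : R, P t = G (clamp d t) - G 0].

(** The integral operator halves the supremum distance, so the iterates of the
    constant [v] form a geometric Cauchy sequence. *)
Lemma picard : exists y : R -> 'rV[R]_n, y 0 = v /\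
  forall t : R, `|t| < d -> is_derive t 1 y (y t *m B t).
Proof.
have /choice[P PP] : forall g, exists P, primitive_spec g P by exact: clamped_primitive.
pose T (y : R -> 'rV[R]_n) (t : R) : 'rV[R]_n := v + \row_j P (field y j) t.
have Tc y : continuous_entries y -> continuous_entries (T y).
  move=> yc j s; rewrite (_ : (fun s => _) = fun s => v 0 j + P (field y j) s); last first.
    by apply/funext => t; rewrite !mxE.
  have [Pc _ _ _] := PP (field _ j) (field_continuous yc).
  by apply: continuousD; [exact: cst_continuous|exact: Pc].
have Tlip (y z : R -> 'rV[R]_n) (m : R) : continuous_entries y -> continuous_entries z ->
    (forall s i, `|y s 0 i - z s 0 i| <= m) ->
    forall s i, `|T y s 0 i - T z s 0 i| <= m / 2.
  move=> yc zc yz s i; rewrite !mxE opprD addrACA subrr add0r.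
  have [_ _ _ [G dG GE]] := PP (field _ i) (field_continuous yc).
  have [_ _ _ [H dH HE]] := PP (field _ i) (field_continuous zc).
  have m0 := le_trans (normr_ge0 _) (yz 0 i).
  rewrite GE HE (le_trans (clamped_primitive_lipschitz d01 dG dH (field_lip _ yz) s)) //.
  by rewrite mulrA mulrC ler_wpM2l.
pose Y k := iter k T (fun=> v).
have Yc k : continuous_entries (Y k).
  by elim: k => [|k IH]; [move=> j; exact: cst_continuous|exact: Tc].
have [C Y01] : exists C : R, forall s i, `|Y 1%N s 0 i - Y 0%N s 0 i| <= C.
  have c0 : continuous_entries (fun=> 0) by move=> j; exact: cst_continuous.
  exists (`|v| / 2) => s i.
  have vb (s' : R) i' : `|Y 0%N s' 0 i' - (fun=> 0 : 'rV[R]_n) s' 0 i'| <= `|v|.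
    by rewrite mxE subr0; exact: mx_entry_le_norm.
  have := Tlip _ _ _ (Yc 0%N) c0 vb s i; congr (`|_| <= _); congr (_ - _).
  rewrite !mxE; have [_ _ _ [G dG GE]] := PP (field _ i) (field_continuous c0).
  have z0 t : `|field (fun=> 0) i t - 0| <= 0.
    by rewrite /field mul0mx mxE subr0 normr0.
  have dcst (t : R) : -2 < t < 2 -> is_derive t 1 (cst 0 : R -> R) 0.
    by move=> _; exact: is_derive_cst.
  have := clamped_primitive_lipschitz d01 dG dcst z0 s.
  by rewrite mulr0 subrr subr0 normr_le0 GE => /eqP ->; rewrite addr0.
have Ystep k s i : `|Y k.+1 s 0 i - Y k s 0 i| <= C / 2 ^+ k.
  elim: k s i => [|k IH] s i; first by rewrite expr0 divr1.
  by have := Tlip _ _ _ (Yc k.+1) (Yc k) IH s i; rewrite exprSr invfM mulrA.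
(* The distance from the [k]-th iterate to the limit is at most [D / 2 ^+ k]; the
   limit is the common point of nested intervals, entry by entry. *)
pose D : R := 2 * C.
pose lo s i := [set Y k s 0 i - D / 2 ^+ k | k in [set: nat]].
have half k : C / 2 ^+ k = D / 2 ^+ k.+1.
  by rewrite /D exprS -mulf_div divff // mul1r.
have lohi k m s i : Y k s 0 i - D / 2 ^+ k <= Y m s 0 i + D / 2 ^+ m.
  have lo1 k' : Y k' s 0 i - D / 2 ^+ k' <= Y k'.+1 s 0 i - D / 2 ^+ k'.+1.
    have := Ystep k' s i; rewrite ler_norml half => /andP[+ _].
    rewrite (_ : D / 2 ^+ k' = D / 2 ^+ k'.+1 + D / 2 ^+ k'.+1); first lra.
    by rewrite -half /D; lra.
  have hi1 k' : Y k'.+1 s 0 i + D / 2 ^+ k'.+1 <= Y k' s 0 i + D / 2 ^+ k'.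
    have := Ystep k' s i; rewrite ler_norml half => /andP[_].
    rewrite (_ : D / 2 ^+ k' = D / 2 ^+ k'.+1 + D / 2 ^+ k'.+1); first lra.
    by rewrite -half /D; lra.
  have loM k1 k2 : (k1 <= k2)%N -> Y k1 s 0 i - D / 2 ^+ k1 <= Y k2 s 0 i - D / 2 ^+ k2.
    move=> /subnK <-; elim: (k2 - k1)%N => [|q IH] //; exact: le_trans IH (lo1 _).
  have hiM k1 k2 : (k1 <= k2)%N -> Y k2 s 0 i + D / 2 ^+ k2 <= Y k1 s 0 i + D / 2 ^+ k1.
    move=> /subnK <-; elim: (k2 - k1)%N => [|q IH] //; exact: le_trans (hi1 _) IH.
  have C0 : 0 <= D / 2 ^+ maxn k m.
    by rewrite divr_ge0 ?exprn_ge0 // mulr_ge0 // (le_trans (normr_ge0 _) (Y01 0 i)).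
  apply: le_trans (loM _ _ (leq_maxl k m)) _.
  apply: le_trans _ (hiM _ _ (leq_maxr k m)); lra.
pose y s : 'rV[R]_n := \row_i sup (lo s i).
have yY k s i : `|y s 0 i - Y k s 0 i| <= D / 2 ^+ k.
  rewrite mxE ler_norml; apply/andP; split.
    rewrite lerBrDl; apply: ub_le_sup; last by exists k.
    by exists (Y 0%N s 0 i + D / 2 ^+ 0) => _ [q _ <-].
  rewrite lerBlDl; apply: ge_sup; first by exists (Y 0%N s 0 i - D / 2 ^+ 0), 0%N.
  by move=> _ [q _ <-].
have small (e : R) : 0 < e -> exists k, D / 2 ^+ k < e.
  move=> e0; have : (fun k => D * (2^-1) ^+ k) @ \oo --> D * 0.
    by apply: cvgMr; apply: cvg_expr; rewrite ger0_norm //; lra.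
  rewrite mulr0 => /cvgrPdist_lt /(_ _ e0) [k _ /(_ k (leqnn k))] /=.
  by rewrite sub0r normrN exprVn => H; exists k; exact: le_lt_trans (ler_norm _) H.
have yc : continuous_entries y.
  move=> i s; apply/cvgrPdist_lt => e e0.
  have e3 : 0 < e / 3 by rewrite divr_gt0.
  have [k ke] := small _ e3.
  have /cvgrPdist_lt /(_ _ e3) := Yc k i s.
  apply: filterS => t; have := yY k s i; have := yY k t i.
  rewrite !ler_norml !ltr_norml; lra.
have yT t i : y t 0 i = T y t 0 i.
  apply/eqP; rewrite -subr_eq0 -normr_eq0 eq_le normr_ge0 andbT.
  apply/ler_addgt0Pl => e e0; rewrite addr0.
  have [k ke] := small _ (divr_gt0 e0 (ltr0n R 2)).
  have H1 := yY k.+1 t i; have H2 := Tlip _ _ _ yc (Yc k) (yY k) t i.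
  have E : D / 2 ^+ k.+1 = D / 2 ^+ k / 2 by rewrite exprSr invfM mulrA.
  have H3 : 0 <= D / 2 ^+ k by exact: le_trans (normr_ge0 _) (yY k t i).
  move: H1 H2; rewrite -/(Y k.+1) E (_ : T (Y k) = Y k.+1) // !ler_norml; lra.
exists y; split.
  apply/rowP => i; rewrite yT !mxE.
  by have [_ -> _ _] := PP (field _ i) (field_continuous yc); rewrite addr0.
move=> t td; apply/is_derive_rowP => j.
rewrite (_ : (fun s => _) = cst (v 0 j) + P (field y j)); last first.
  by apply/funext => s; rewrite yT !mxE.
rewrite -[X in is_derive _ _ _ X]add0r; apply: is_deriveD.
by have [_ _ dP _] := PP (field _ j) (field_continuous yc); exact: dP.
Qed.

End Picard.

Section FundamentalMatrix.
Context {R : realType}.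

Lemma is_derive_sumE (V W : normedModType R) n (f : 'I_n -> V -> W)
    (df : 'I_n -> W) (x v : V) :
  (forall i, is_derive x v (f i) (df i)) ->
  is_derive x v (fun z => \sum_(i < n) f i z) (\sum_(i < n) df i).
Proof.
move=> dfi; have := is_derive_sum dfi; congr (is_derive _ _ _ _).
by apply/funext => z; rewrite fct_sumE.
Qed.

Lemma zero_derive_constant (f : R -> R) (d : R) :
  (forall t : R, `|t| < d -> is_derive t 1 f 0) -> forall t : R, `|t| < d -> f t = f 0.
Proof.
move=> df t td.
have MV (a b : R) : a < b -> `|a| < d -> `|b| < d -> f b = f a.
  move=> ab ad bd; have abd (s : R) : a <= s <= b -> `|s| < d.
    move=> /andP[sa sb]; move: ad bd; rewrite !ltr_norml => /andP[a1 _] /andP[_ b2].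
    by rewrite (lt_le_trans a1 sa) (le_lt_trans sb b2).
  have cf : {within `[a, b], continuous f}.
    apply: derivable_within_continuous => s; rewrite in_itv /= => /abd sd.
    by have [] := df _ sd.
  have dfab s : s \in `]a, b[ -> is_derive s 1 f 0.
    by rewrite in_itv /= => /andP[/ltW sa /ltW sb]; apply/df/abd/andP.
  have [s _] := MVT ab dfab cf; rewrite mul0r => /eqP.
  by rewrite subr_eq0 => /eqP.
have d0 : `|0 : R| < d by rewrite normr0 (le_lt_trans _ td).
by have [t0|t0|->//] := ltgtP t 0; [rewrite (MV t 0)|rewrite (MV 0 t)].
Qed.

(** Clamping the argument of [B] makes it bounded and continuous on the whole
    line, and [d] is then chosen so small that the integral operator contracts. *)
Lemma linear_ode n (B : R -> 'M[R]_n) (r : R) : 0 < r ->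
  (forall t : R, `|t| < r -> {for t, continuous B}) ->
  exists d : R, 0 < d /\ forall v, exists y : R -> 'rV[R]_n, y 0 = v /\
    forall t : R, `|t| < d -> is_derive t 1 y (y t *m B t).
Proof.
move=> r0 Bc.
have B0 : {for 0, continuous B} by apply: Bc; rewrite normr0.
pose K := `|B 0| + 1; have Kpos : 0 < K by rewrite ltr_wpDl.
have [q q0 qK] : exists2 q : R, 0 < q & forall s, `|s| < q -> `|B s| <= K.
  have /cvgrPdist_lt /(_ 1 ltr01) /nbhs_normP [q /= q0 qP] := B0.
  exists q => // s sq; have /qP /= : `|0 - s| < q by rewrite sub0r normrN.
  move=> H; rewrite -[B s](subrK (B 0)) addrC (le_trans (ler_normD _ _)) // lerD2l.
  by rewrite distrC ltW.
pose a := Num.min (r / 2) (q / 2).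
have a0 : 0 < a by rewrite lt_min !divr_gt0.
have ar : a < r by rewrite gt_min ltr_pdivrMr // ltr_pMr // ltr1n.
have aq : a < q by rewrite gt_min [X in _ || X]ltr_pdivrMr // ltr_pMr // ltr1n orbT.
(* The summand [1] keeps [N] positive when [n] is zero. *)
pose N : R := 2 * (n%:R * K) + 1.
have N0 : 0 < N by rewrite ltr_wpDl // mulr_ge0 // mulr_ge0 // ltW.
pose d := Num.min (Num.min a 1) N^-1.
have d0 : 0 < d by rewrite lt_min [X in X && _]lt_min a0 ltr01 invr_gt0 N0.
have da : d <= a by rewrite ge_min [X in X || _]ge_min lexx.
have d1 : d <= 1 by rewrite ge_min [X in X || _]ge_min lexx orbT.
have dN : d <= N^-1 by rewrite ge_min lexx orbT.
have dK : d * (n%:R * K) <= 2^-1.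
  have : d * N <= 1 by rewrite -ler_pdivlMr // div1r.
  rewrite /N; lra.
exists d; split=> // v.
have Bcl i j : continuous (fun s => B (clamp a s) i j).
  move=> s; apply: (@continuous_comp _ _ _ (clamp a) (fun t => B t i j)).
    exact: clamp_continuous.
  apply: (@continuous_comp _ _ _ B (fun A : 'M[R]_n => A i j)).
    by apply: Bc; rewrite (le_lt_trans _ ar) // clamp_le // ltW.
  exact: coord_continuous.
have BclK s i j : `|B (clamp a s) i j| <= K.
  apply: le_trans (mx_entry_le_norm _ _ _) _; apply: qK.
  by rewrite (le_lt_trans _ aq) // clamp_le // ltW.
have [|y [y0 dy]] := @picard R n (fun s => B (clamp a s)) K d v Bcl BclK _ dK.
  by rewrite d0.
exists y; split=> // t td; have := dy t td.
by rewrite clamp_id // (lt_le_trans td).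
Qed.

(** The inverse of a fundamental matrix solves the dual equation; solving both
    equations avoids differentiating a matrix inverse. *)
Lemma fundamental_matrix n (B : R -> 'M[R]_n) (r : R) : 0 < r ->
  (forall t : R, `|t| < r -> {for t, continuous B}) ->
  exists (d : R) (Y Z : R -> 'M[R]_n), [/\ 0 < d, Y 0 = 1%:M /\ Z 0 = 1%:M,
    forall (t : R) i j, `|t| < d -> is_derive t 1 (fun s => Y s i j) ((Y t *m B t) i j),
    forall (t : R) i j, `|t| < d -> is_derive t 1 (fun s => Z s i j) (- (B t *m Z t) i j) &
    forall t : R, `|t| < d -> Y t *m Z t = 1%:M].
Proof.
move=> r0 Bc.
(* The columns of [Z], written as rows, solve [z' = - z *m B^T]. *)
have BTc : forall t : R, `|t| < r -> {for t, continuous (fun s => - (B s)^T)}.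
  move=> t tr; apply/cvgrPdist_lt => e e0.
  have /cvgrPdist_lt /(_ _ e0) := Bc t tr; apply: filterS => s.
  rewrite -opprD normrN -linearB /=; congr (_ < _).
  rewrite (_ : `|B t - B s| = mx_norm (B t - B s)) // (_ : `|(B t - B s)^T| = mx_norm (B t - B s)^T) //.
  rewrite !mx_normrE; apply/eqP; rewrite eq_le; apply/andP; split.
    apply/bigmax_leP; split=> [|[i j] _] /=; first by rewrite bigmax_idl le_max lexx.
    by have := @le_bigmax _ _ _ 0 (fun ij : 'I_n * 'I_n => `|(B t - B s)^T ij.1 ij.2|) (j, i); rewrite /= mxE.
  apply/bigmax_leP; split=> [|[i j] _] /=; first by rewrite bigmax_idl le_max lexx.
  by have := @le_bigmax _ _ _ 0 (fun ij : 'I_n * 'I_n => `|(B t - B s) ij.1 ij.2|) (j, i); rewrite /= [(_ - _)^T _ _]mxE.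
have [d1 [d10 /choice[Y YP]]] := linear_ode r0 Bc.
have [d2 [d20 /choice[Z ZP]]] := linear_ode r0 BTc.
pose YY t := \matrix_(i, j) Y (unit_row R i) t 0 j.
pose ZZ t := \matrix_(i, j) Z (unit_row R j) t 0 i.
have YYd (t : R) (i j : 'I_n) : `|t| < d1 -> is_derive t 1 (fun s => YY s i j) ((YY t *m B t) i j).
  move=> td; have [_ /(_ t td) /is_derive_rowP /(_ j)] := YP (unit_row R i).
  congr (is_derive _ _ _ _); first by apply/funext => s; rewrite mxE.
  by rewrite !mxE; apply: eq_bigr => k _; rewrite mxE.
have ZZd (t : R) (i j : 'I_n) : `|t| < d2 -> is_derive t 1 (fun s => ZZ s i j) (- (B t *m ZZ t) i j).
  move=> td; have [_ /(_ t td) /is_derive_rowP /(_ i)] := ZP (unit_row R j).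
  congr (is_derive _ _ _ _); first by apply/funext => s; rewrite mxE.
  rewrite !mxE -sumrN; apply: eq_bigr => k _; rewrite !mxE mulrN; congr (- _).
  exact: mulrC.
have Y0 : YY 0 = 1%:M.
  by apply/matrixP => i j; rewrite !mxE (YP (unit_row R i)).1 mxE eqxx eq_sym.
have Z0 : ZZ 0 = 1%:M.
  by apply/matrixP => i j; rewrite !mxE (ZP (unit_row R j)).1 mxE eqxx.
exists (Num.min d1 d2), YY, ZZ; split.
- by rewrite lt_min d10.
- by [].
- by move=> t i j; rewrite lt_min => /andP[td _]; exact: YYd.
- by move=> t i j; rewrite lt_min => /andP[_ td]; exact: ZZd.
- move=> t td; apply/matrixP => i j.
  have cst0 (s : R) : `|s| < Num.min d1 d2 -> is_derive s 1 (fun s => (YY s *m ZZ s) i j) 0.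
    rewrite lt_min => /andP[s1 s2].
    have -> : (fun s => (YY s *m ZZ s) i j) = (fun s => \sum_k (YY s i k * ZZ s k j)).
      by apply/funext => q; rewrite mxE.
    have E0 : \sum_k (YY s i k * (- (B s *m ZZ s) k j) + ZZ s k j * (YY s *m B s) i k) = 0.
      rewrite big_split /= (eq_bigr (fun k => - (YY s i k * (B s *m ZZ s) k j))); last first.
        by move=> k _; rewrite mulrN.
      rewrite sumrN addrC; apply/eqP; rewrite subr_eq0; apply/eqP.
      transitivity ((YY s *m B s *m ZZ s) i j); last by rewrite -mulmxA mxE.
      by rewrite [RHS]mxE; apply: eq_bigr => k _; rewrite mulrC.
    rewrite -[X in is_derive _ _ _ X]E0.
    apply: (@is_derive_sumE _ _ n (fun k s => YY s i k * ZZ s k j)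
      (fun k => YY s i k * (- (B s *m ZZ s) k j) + ZZ s k j * (YY s *m B s) i k)).
    by move=> k; apply: is_deriveM; [exact: YYd|exact: ZZd].
  by rewrite (zero_derive_constant cst0) // Y0 Z0 mulmx1.
Qed.

End FundamentalMatrix.

(** * Tangent vectors and fields in charts *)

Lemma diff_comp_at {R : realType} (U V W : normedModType R) (f : U -> V) (g : V -> W)
    (x y : U) : differentiable f x -> differentiable g (f x) ->
  'd (g \o f) x y = 'd g (f x) ('d f x y).
Proof. by move=> df dg; rewrite diff_comp. Qed.

Section ChartCalculus.
Context {R : realType} {n : nat} {M : topologicalType}.
Variable S : smooth_manifold R n M.
Implicit Types (u w z : chart R n M) (q : M) (x y : 'rV[R]_n).

Lemma chart_img_map u q : chart_dom u q -> chart_img u (u q).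
Proof. by move=> uq; exists q. Qed.

Lemma chart_img_inv u x : chart_img u x ->
  chart_dom u (chart_inv u x) /\ u (chart_inv u x) = x.
Proof. by move=> [q uq <-]; rewrite chart_mapK. Qed.

Lemma image_chartP u (A : set M) x :
  (u @` (A `&` chart_dom u)) x <-> chart_img u x /\ A (chart_inv u x).
Proof.
split=> [[q [Aq uq] <-]|[/chart_img_inv [ux xK] Ax]].
  by split; [exact: chart_img_map|rewrite chart_mapK].
by exists (chart_inv u x).
Qed.

Lemma image_chart_open u (A : set M) : open A -> open (u @` (A `&` chart_dom u)).
Proof.
move=> oA; rewrite openE => x /image_chartP [ux Ax].
have nA : \forall z \near x, A (chart_inv u z).
  by apply: (chart_inv_cont ux); exact: open_nbhs_nbhs.
have nu : \forall z \near x, chart_img u z.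
  by apply: open_nbhs_nbhs; split => //; exact: chart_img_open.
by apply: filterS2 nA nu => z Az uz; apply/image_chartP.
Qed.

Lemma near_chart_inv u x (A : set M) : chart_img u x -> open A -> A (chart_inv u x) ->
  \forall z \near x, chart_img u z /\ A (chart_inv u z).
Proof.
move=> ux oA Ax.
have : \forall z \near x, (u @` (A `&` chart_dom u)) z.
  by apply: open_nbhs_nbhs; split; [exact: image_chart_open|exact/image_chartP].
by apply: filterS => z /image_chartP.
Qed.

Lemma transition_smooth u w : atlas S u -> atlas S w ->
  smooth_on (u @` (chart_dom w `&` chart_dom u)) (transition u w).
Proof. by move=> au aw; rewrite setIC; exact: (atlas_compatible au aw).1. Qed.

Lemma overlap_map u w q : chart_dom u q -> chart_dom w q ->
  (u @` (chart_dom w `&` chart_dom u)) (u q).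
Proof. by move=> uq wq; exists q. Qed.

Lemma overlap_open u w : open (u @` (chart_dom w `&` chart_dom u)).
Proof. exact/image_chart_open/chart_dom_open. Qed.

Lemma transition_overlap u w x :
  (u @` (chart_dom w `&` chart_dom u)) x ->
  (w @` (chart_dom u `&` chart_dom w)) (transition u w x).
Proof. by move=> [q [wq uq] <-]; exists q => //; rewrite /transition chart_mapK. Qed.

Lemma transition_map u w q : chart_dom u q -> transition u w (u q) = w q.
Proof. by move=> uq; rewrite /transition chart_mapK. Qed.

Lemma transition_differentiable u w q : atlas S u -> atlas S w ->
  chart_dom u q -> chart_dom w q -> differentiable (transition u w) (u q).
Proof. by move=> au aw uq wq; apply: (transition_smooth au aw 1).1; exists q. Qed.

(** The cocycle identity of tangent maps, from which the coordinate changes of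
    tangent vectors follow. *)
Lemma diff_transition_comp u w z q y : atlas S u -> atlas S w -> atlas S z ->
  chart_dom u q -> chart_dom w q -> chart_dom z q ->
  'd (transition w z) (w q) ('d (transition u w) (u q) y) =
  'd (transition u z) (u q) y.
Proof.
move=> au aw az uq wq zq.
have duw := transition_differentiable au aw uq wq.
have dwz : differentiable (transition w z) (transition u w (u q)).
  by rewrite transition_map //; exact: transition_differentiable.
have E : 'd (transition u z) (u q) = 'd (transition w z \o transition u w) (u q) :> (_ -> _).
  apply: near_eq_diff; last exact: differentiable_comp.
  have := near_chart_inv (chart_img_map uq) (chart_dom_open w).
  rewrite chart_mapK // => /(_ wq); apply: filterS => x [ux wx].
  by rewrite /= /transition chart_mapK.
apply: etrans (esym (etrans (congr1 (@^~ y) E) (diff_comp_at y duw dwz))).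
by rewrite (transition_map w uq).
Qed.

Lemma diff_transition_id u q y : chart_dom u q -> 'd (transition u u) (u q) y = y.
Proof.
move=> uq; have -> : 'd (transition u u) (u q) = 'd id (u q) :> (_ -> _).
  apply: near_eq_diff => //.
  have := near_chart_inv (chart_img_map uq) (chart_dom_open u).
  rewrite chart_mapK // => /(_ uq); apply: filterS => x [/chart_img_inv [_ xK] _].
  by rewrite /transition xK.
by rewrite diff_val.
Qed.

Lemma tcoord_tvec u w q y : atlas S u -> atlas S w -> chart_dom u q -> chart_dom w q ->
  tcoord S w q (tvec S u q y) = 'd (transition u w) (u q) y.
Proof.
move=> au aw uq wq; apply: diff_transition_comp => //; first exact: chart_at_atlas.
exact: chart_at_dom.
Qed.

Lemma tvecK u q y : atlas S u -> chart_dom u q -> tcoord S u q (tvec S u q y) = y.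
Proof. by move=> au uq; rewrite tcoord_tvec // diff_transition_id. Qed.

Lemma tcoordK u q y : atlas S u -> chart_dom u q -> tvec S u q (tcoord S u q y) = y.
Proof.
move=> au uq; rewrite /tvec /tcoord diff_transition_comp ?diff_transition_id //;
  by [exact: chart_at_dom|exact: chart_at_atlas].
Qed.

Lemma tcoord_linear u q : linear (tcoord S u q).
Proof. by move=> a x y; rewrite /tcoord linearP. Qed.
HB.instance Definition _ u q :=
  GRing.isLinear.Build R 'rV[R]_n 'rV[R]_n _ (tcoord S u q) (tcoord_linear u q).

Lemma tvec_linear u q : linear (tvec S u q).
Proof. by move=> a x y; rewrite /tvec linearP. Qed.
HB.instance Definition _ u q :=
  GRing.isLinear.Build R 'rV[R]_n 'rV[R]_n _ (tvec S u q) (tvec_linear u q).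

Lemma tvec_sum u q y : tvec S u q y = \sum_(i < n) y 0 i *: coord_field S u i q.
Proof.
rewrite {1}(row_sum_unit y) linear_sum; apply: eq_bigr => i _.
by rewrite linearZ.
Qed.

Lemma coord_field_loc u w i x : atlas S u -> atlas S w ->
  (w @` (chart_dom u `&` chart_dom w)) x ->
  field_loc S w (coord_field S u i) x =
  'D_(unit_row R i) (transition u w) (transition w u x).
Proof.
move=> au aw [q [uq wq] <-]; rewrite /field_loc /coord_field chart_mapK // tcoord_tvec //.
rewrite /transition chart_mapK // deriveE //; exact: transition_differentiable.
Qed.

Lemma coord_field_smooth u q i : atlas S u -> chart_dom u q ->
  smooth_field_near S q (coord_field S u i).
Proof.
move=> au uq; exists (chart_dom u); split => //; first exact: chart_dom_open.
move=> w aw k; apply: (@Ck_on_eq _ _ _ k _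
  (fun x => 'D_(unit_row R i) (transition u w) (transition w u x))).
- exact: overlap_open.
- by move=> x wx; rewrite coord_field_loc.
apply: (@Ck_on_comp _ _ k _ n n (u @` (chart_dom w `&` chart_dom u))
  (transition w u) ('D_(unit_row R i) (transition u w))).
- exact: overlap_open.
- exact: overlap_open.
- exact: transition_overlap.
- exact: transition_smooth.
- exact: (transition_smooth au aw k.+1).2.
Qed.

(** Transition maps are smooth, so one chart suffices to test smoothness. *)
Lemma smooth_fun_near_chart u q (U : set M) (f : M -> R) : atlas S u ->
  chart_dom u q -> open U -> U q ->
  smooth_on (u @` (U `&` chart_dom u)) (fun x => f (chart_inv u x)) ->
  smooth_fun_near S q f.
Proof.
move=> au uq oU Uq fs; exists (U `&` chart_dom u); split => //.
  exact/openI/chart_dom_open.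
move=> w aw k.
have oV : open (w @` (U `&` chart_dom u `&` chart_dom w)).
  exact/image_chart_open/openI/chart_dom_open.
apply: (@Ck_on_eq _ _ _ k _ (fun x => f (chart_inv u (transition w u x)))) => //.
  move=> x /image_chartP [wx [_ ux]]; rewrite /transition.
  by rewrite (chart_mapK ux).
apply: (@Ck_on_comp_scalar _ _ k _ n (u @` (U `&` chart_dom u)) (transition w u)
  (fun x => f (chart_inv u x))) => //.
- move=> x /image_chartP [wx [Ux ux]]; apply/image_chartP.
  by rewrite /transition; split; [exact: chart_img_map|rewrite chart_mapK].
- apply: Ck_on_sub (transition_smooth aw au k) => x /image_chartP [wx [_ ux]].
  by apply/image_chartP.
Qed.

Lemma smooth_field_coord u q (X : M -> 'rV[R]_n) i : atlas S u -> chart_dom u q ->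
  smooth_field_near S q X -> smooth_fun_near S q (fun z : M => tcoord S u z (X z) 0 i).
Proof.
move=> au uq [U [oU Uq Xs]].
apply: (smooth_fun_near_chart au uq oU Uq) => k.
by apply: (@Ck_on_coord _ _ k _ n (field_loc S u X)); [exact: image_chart_open|exact: Xs].
Qed.

Lemma field_loc_differentiable u q (X : M -> 'rV[R]_n) : atlas S u -> chart_dom u q ->
  smooth_field_near S q X -> differentiable (field_loc S u X) (u q).
Proof.
move=> au uq [U [oU Uq Xs]]; apply: (Xs u au 1%N).1; apply/image_chartP.
by split; [exact: chart_img_map|rewrite chart_mapK].
Qed.

Lemma dfun_tvec u q (f : M -> R) y : atlas S u -> chart_dom u q ->
  smooth_fun_near S q f ->
  dfun S f q (tvec S u q y) = 'd (fun x => f (chart_inv u x)) (u q) y.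
Proof.
move=> au uq [U [oU Uq fs]]; set c := chart_at S q.
have [ac cq] : atlas S c /\ chart_dom c q by split; [exact: chart_at_atlas|exact: chart_at_dom].
have duc := transition_differentiable au ac uq cq.
have df : differentiable (fun x => f (chart_inv c x)) (transition u c (u q)).
  rewrite transition_map //; apply: (fs c ac 1%N).1; apply/image_chartP.
  by split; [exact: chart_img_map|rewrite chart_mapK].
have E : 'd (fun x => f (chart_inv u x)) (u q) =
    'd ((fun x => f (chart_inv c x)) \o transition u c) (u q) :> (_ -> _).
  apply: near_eq_diff; last exact: differentiable_comp.
  have := near_chart_inv (chart_img_map uq) (chart_dom_open c).
  rewrite chart_mapK // => /(_ cq); apply: filterS => x [ux cx].
  by rewrite /= /transition chart_mapK.
apply: etrans (esym (etrans (congr1 (@^~ y) E) (diff_comp_at y duc df))).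
by rewrite (transition_map c uq).
Qed.

End ChartCalculus.

(** * Linear connections in charts *)

Section Connections.
Context {R : realType} {n : nat} {M : topologicalType}.
Variable S : smooth_manifold R n M.
Local Notation field := (M -> 'rV[R]_n).
Implicit Types (u w : chart R n M) (q : M) (f g : M -> R) (X Y : field).

Lemma smooth_fun_near_eq_cst q (U : set M) f (a : R) : open U -> U q ->
  (forall z, U z -> f z = a) -> smooth_fun_near S q f.
Proof.
move=> oU Uq fa; exists U; split => // u au k.
apply: (@Ck_on_eq _ _ _ k _ (fun=> a)); first exact: image_chart_open.
  by move=> x /image_chartP [_ Ux]; rewrite fa.
exact: Ck_on_cst.
Qed.

Lemma smooth_fun_near_cst q (a : R) : smooth_fun_near S q (fun=> a).
Proof. by apply: (@smooth_fun_near_eq_cst q setT) => //; exact: openT. Qed.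

Lemma dfun_eq_cst q (U : set M) f (a : R) (v : 'rV[R]_n) : open U -> U q ->
  (forall z, U z -> f z = a) -> dfun S f q v = 0.
Proof.
move=> oU Uq fa; rewrite /dfun; set c := chart_at S q.
have cq : chart_dom c q by exact: chart_at_dom.
have E : 'd (fun x => f (chart_inv c x)) (c q) = 'd (cst a) (c q) :> ('rV[R]_n -> R).
  apply: near_eq_diff; last exact: differentiable_cst.
  have := near_chart_inv (chart_img_map cq) oU.
  by rewrite chart_mapK // => /(_ Uq); apply: filterS => x [_ Ux]; rewrite fa.
by rewrite E diff_cst.
Qed.

Lemma smooth_field_near_lin q f X Y : smooth_fun_near S q f ->
  smooth_field_near S q X -> smooth_field_near S q Y ->
  smooth_field_near S q (fun z => f z *: X z + Y z).
Proof.
move=> [U [oU Uq fs]] [V [oV Vq Xs]] [W [oW Wq Ys]].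
have oUVW : open (U `&` V `&` W) by apply: openI => //; exact: openI.
exists (U `&` V `&` W); split => //.
move=> u au k; have oD : open (u @` (U `&` V `&` W `&` chart_dom u)).
  exact: image_chart_open.
apply: (@Ck_on_eq _ _ _ k _ (fun x => f (chart_inv u x) *: field_loc S u X x + field_loc S u Y x)) => //.
  by move=> x _; rewrite /field_loc linearP.
apply: (@Ck_on_row _ _ k _ n) => // j.
apply: (@Ck_on_eq _ _ _ k _ (fun x => f (chart_inv u x) * field_loc S u X x 0 j + field_loc S u Y x 0 j)) => //.
  by move=> x _; rewrite !mxE.
apply: Ck_on_add => //; first apply: Ck_on_mul => //.
- by apply: Ck_on_sub (fs u au k); apply: image_subset => z [[[]]].
- apply: (@Ck_on_coord _ _ k _ n (field_loc S u X)) => //.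
  by apply: Ck_on_sub (Xs u au k); apply: image_subset => z [[[]]].
- apply: (@Ck_on_coord _ _ k _ n (field_loc S u Y)) => //.
  by apply: Ck_on_sub (Ys u au k); apply: image_subset => z [[[]]].
Qed.

Lemma smooth_field_near0 q : smooth_field_near S q (fun=> 0).
Proof.
exists setT; split => //; first exact: openT.
move=> u au k; rewrite (_ : field_loc S u _ = fun=> 0); first exact: Ck_on_cst.
by apply/funext => x; rewrite /field_loc linear0.
Qed.

Lemma smooth_field_near_sum q m (f : 'I_m -> M -> R) (X : 'I_m -> field) :
  (forall i, smooth_fun_near S q (f i)) -> (forall i, smooth_field_near S q (X i)) ->
  smooth_field_near S q (fun z => \sum_(i < m) f i z *: X i z).
Proof.
elim: m f X => [|m IH] f X fs Xs.
  rewrite (_ : (fun z => _) = fun=> 0); first exact: smooth_field_near0.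
  by apply/funext => z; rewrite big_ord0.
rewrite (_ : (fun z => _) = fun z => f ord0 z *: X ord0 z +
   \sum_(i < m) f (lift ord0 i) z *: X (lift ord0 i) z); last first.
  by apply/funext => z; rewrite big_ord_recl.
by apply: smooth_field_near_lin => //; exact: IH.
Qed.

Variable nabla : field -> field -> field.
Hypothesis nablaC : linear_connection S nabla.

Lemma nabla0l q Y : smooth_field_near S q Y -> nabla (fun=> 0) Y q = 0.
Proof.
move=> Ys; have s0 := smooth_field_near0 q.
have [+ _ _ _] := nablaC (smooth_fun_near_cst q 1) s0 s0 Ys Ys.
rewrite !scale1r (_ : (fun q0 => _) = (fun=> 0)); last first.
  by apply/funext => z; rewrite addr0.
by move=> /eqP; rewrite -subr_eq subrr eq_sym => /eqP.
Qed.

Lemma nabla0r q X : smooth_field_near S q X -> nabla X (fun=> 0) q = 0.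
Proof.
move=> Xs; have s0 := smooth_field_near0 q.
have [_ + _ _] := nablaC (smooth_fun_near_cst q 1) Xs Xs s0 s0.
rewrite (_ : (fun q0 => _) = (fun=> 0)); last first.
  by apply/funext => z; rewrite addr0.
by move=> /eqP; rewrite -subr_eq subrr eq_sym => /eqP.
Qed.

Lemma nabla_scalel q f X Y : smooth_fun_near S q f -> smooth_field_near S q X ->
  smooth_field_near S q Y -> nabla (fun z => f z *: X z) Y q = f q *: nabla X Y q.
Proof.
move=> fs Xs Ys; have s0 := smooth_field_near0 q.
have [+ _ _ _] := nablaC fs Xs s0 Ys Ys.
rewrite nabla0l // addr0 => <-; congr (nabla _ _ _).
by apply/funext => z; rewrite addr0.
Qed.

(** The indicator of an open set is smooth near its points, and so may be used as
    a cut-off: multiplying a field by it changes neither the field near [q] nor,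
    by the Leibniz rule, the value of [nabla] at [q]. *)
Lemma nabla_local q (U : set M) X X' Y Y' : open U -> U q ->
  smooth_field_near S q X -> smooth_field_near S q X' ->
  smooth_field_near S q Y -> smooth_field_near S q Y' ->
  (forall z, U z -> X z = X' z) -> (forall z, U z -> Y z = Y' z) ->
  nabla X Y q = nabla X' Y' q.
Proof.
move=> oU Uq Xs Xs' Ys Ys' XX YY.
have U1 z : U z -> \1_U z = 1 :> R by move=> Uz; rewrite indicE mem_set.
have fs : smooth_fun_near S q (\1_U : M -> R) by exact: smooth_fun_near_eq_cst U1.
have cut (Z Z' : field) : (forall z, U z -> Z z = Z' z) ->
    (fun z => \1_U z *: Z z) = (fun z => \1_U z *: Z' z).
  move=> ZZ; apply/funext => z; rewrite indicE.
  by case: (boolP (z \in U)) => [/set_mem /ZZ ->//|_]; rewrite !scale0r.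
have L (Z : field) : smooth_field_near S q Z ->
    nabla Z Y q = nabla (fun z => \1_U z *: Z z) Y q.
  by move=> Zs; rewrite nabla_scalel // U1 // scale1r.
have Rr (Z : field) : smooth_field_near S q Z ->
    nabla X' Z q = nabla X' (fun z => \1_U z *: Z z) q.
  move=> Zs; have [_ _ -> _] := nablaC fs Xs' Xs' Zs Zs.
  by rewrite U1 // scale1r (dfun_eq_cst _ oU Uq U1) scale0r addr0.
by rewrite L // (cut _ _ XX) -L // Rr // (cut _ _ YY) -Rr.
Qed.

Lemma nabla_suml q m (f : 'I_m -> M -> R) (X : 'I_m -> field) Y :
  (forall i, smooth_fun_near S q (f i)) -> (forall i, smooth_field_near S q (X i)) ->
  smooth_field_near S q Y ->
  nabla (fun z => \sum_(i < m) f i z *: X i z) Y q = \sum_(i < m) f i q *: nabla (X i) Y q.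
Proof.
move=> + + Ys; elim: m f X => [|m IH] f X fs Xs.
  rewrite big_ord0 (_ : (fun z => _) = fun=> 0); first exact: nabla0l.
  by apply/funext => z; rewrite big_ord0.
have tls := smooth_field_near_sum (fun i => fs (lift ord0 i)) (fun i => Xs (lift ord0 i)).
have [E _ _ _] := nablaC (fs ord0) (Xs ord0) tls Ys Ys.
rewrite big_ord_recl -(IH _ _ (fun i => fs (lift ord0 i)) (fun i => Xs (lift ord0 i))) -E.
by congr (nabla _ _ _); apply/funext => z; rewrite big_ord_recl.
Qed.

Lemma nabla_sumr q m (f : 'I_m -> M -> R) (Y : 'I_m -> field) X :
  (forall i, smooth_fun_near S q (f i)) -> (forall i, smooth_field_near S q (Y i)) ->
  smooth_field_near S q X ->
  nabla X (fun z => \sum_(i < m) f i z *: Y i z) q =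
  \sum_(i < m) (f i q *: nabla X (Y i) q + dfun S (f i) q (X q) *: Y i q).
Proof.
move=> + + Xs; elim: m f Y => [|m IH] f Y fs Ys.
  rewrite big_ord0 (_ : (fun z => _) = fun=> 0); first exact: nabla0r.
  by apply/funext => z; rewrite big_ord0.
have tls := smooth_field_near_sum (fun i => fs (lift ord0 i)) (fun i => Ys (lift ord0 i)).
have hs : smooth_field_near S q (fun z => f ord0 z *: Y ord0 z).
  rewrite (_ : (fun z => _) = fun z => f ord0 z *: Y ord0 z + 0).
    exact: smooth_field_near_lin (smooth_field_near0 q).
  by apply/funext => z; rewrite addr0.
have [_ E _ _] := nablaC (smooth_fun_near_cst q 1) Xs Xs hs tls.
have [_ _ E1 _] := nablaC (fs ord0) Xs Xs (Ys ord0) (Ys ord0).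
rewrite big_ord_recl -(IH _ _ (fun i => fs (lift ord0 i)) (fun i => Ys (lift ord0 i))) -E1 -E.
by congr (nabla _ _ _); apply/funext => z; rewrite big_ord_recl.
Qed.

Definition christoffel_map u q (x y : 'rV[R]_n) : 'rV[R]_n :=
  \row_k \sum_(i < n) \sum_(j < n) conn_coef S nabla u q i j k * x 0 i * y 0 j.

Lemma christoffel_mapE u q x y : christoffel_map u q x y = \sum_(i < n) \sum_(j < n)
  (x 0 i * y 0 j) *: tcoord S u q (nabla (coord_field S u i) (coord_field S u j) q).
Proof.
apply/rowP => k; rewrite mxE summxE; apply: eq_bigr => i _.
rewrite summxE; apply: eq_bigr => j _.
by rewrite mxE -mulrA mulrC.
Qed.

(** By locality both fields may be expanded in the coordinate frame; the
    derivative of the components of [Y] comes from the Leibniz rule. *)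
Lemma nabla_chart u q X Y : atlas S u -> chart_dom u q ->
  smooth_field_near S q X -> smooth_field_near S q Y ->
  tcoord S u q (nabla X Y q) =
  'd (field_loc S u Y) (u q) (tcoord S u q (X q)) +
  christoffel_map u q (tcoord S u q (X q)) (tcoord S u q (Y q)).
Proof.
move=> au uq Xs Ys.
pose a (Z : field) i z := tcoord S u z (Z z) 0 i.
have as_ Z : smooth_field_near S q Z -> forall i, smooth_fun_near S q (a Z i).
  by move=> Zs i; exact: smooth_field_coord.
have es i : smooth_field_near S q (coord_field S u i) by exact: coord_field_smooth.
have dec (Z : field) z : chart_dom u z -> Z z = \sum_(i < n) a Z i z *: coord_field S u i z.
  by move=> uz; rewrite -[LHS](tcoordK _ au uz) tvec_sum.
have ss Z : smooth_field_near S q Z ->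
    smooth_field_near S q (fun z => \sum_(i < n) a Z i z *: coord_field S u i z).
  by move=> Zs; apply: smooth_field_near_sum => //; exact: as_.
rewrite (nabla_local (chart_dom_open u) uq Xs (ss _ Xs) Ys (ss _ Ys) (dec X) (dec Y)).
rewrite nabla_suml //; [|exact: as_|exact: ss].
rewrite linear_sum.
have dfl := field_loc_differentiable au uq Ys.
transitivity (\sum_(i < n) \sum_(j < n) ((a X i q * a Y j q) *: tcoord S u q (nabla (coord_field S u i) (coord_field S u j) q)
   + (a X i q * ('d (field_loc S u Y) (u q) (unit_row R i)) 0 j) *: unit_row R j)).
  apply: eq_bigr => i _; rewrite linearZZ nabla_sumr //; last exact: as_.
  rewrite linear_sum scaler_sumr; apply: eq_bigr => j _.
  rewrite linearD !linearZZ scalerDr !scalerA; congr (_ + _); congr ((_ * _) *: _).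
    rewrite /coord_field dfun_tvec //; last exact: as_.
    exact: (congr1 (@^~ (unit_row R i)) (@diff_linear_comp _ _ _ _ (@coordL R n j) _ _
      (@linear_rV_continuous R n _ (@coordL R n j)) dfl)).
  exact: tvecK.
under eq_bigr => i _ do rewrite big_split.
rewrite big_split /= addrC; congr (_ + _); last by rewrite christoffel_mapE.
rewrite [X in 'd _ _ X]row_sum_unit linear_sum; apply: eq_bigr => i _.
rewrite linearZ /= [X in _ *: X]row_sum_unit scaler_sumr.
by apply: eq_bigr => j _; rewrite scalerA.
Qed.

(** The coefficients are components of the field [nabla] makes out of two
    coordinate fields, which is smooth. *)
Lemma conn_coef_continuous u x i j k : atlas S u -> chart_img u x ->
  {for x, continuous (fun x => conn_coef S nabla u (chart_inv u x) i j k)}.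
Proof.
move=> au ux; have [uq xK] := chart_img_inv ux.
have es l : smooth_field_near S (chart_inv u x) (coord_field S u l) by exact: coord_field_smooth.
have [_ _ _ ns] := nablaC (smooth_fun_near_cst (chart_inv u x) 1) (es i) (es i) (es j) (es j).
have := field_loc_differentiable au uq ns; rewrite xK => dn.
apply: differentiable_continuous.
by apply: (@differentiable_linear_comp _ _ _ _ (@coordL R n k)) dn; exact: linear_rV_continuous.
Qed.

End Connections.

(** * Change of chart and parallel frames *)

Section ParallelTransport.
Context {R : realType} {n : nat} {M : topologicalType}.
Variable S : smooth_manifold R n M.
Local Notation field := (M -> 'rV[R]_n).
Implicit Types (u w : chart R n M) (q : M) (X Y : field).
Variable nabla : field -> field -> field.
Hypothesis nablaC : linear_connection S nabla.

Local Notation christoffel_map := (christoffel_map S nabla).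

Lemma christoffel_map_sum_unit u q (L : {linear 'rV[R]_n -> 'rV[R]_n}) (a b : 'rV[R]_n) :
  christoffel_map u q (L a) (L b) = \sum_(i < n) \sum_(j < n)
    (a 0 i * b 0 j) *: christoffel_map u q (L (unit_row R i)) (L (unit_row R j)).
Proof.
have LE (x : 'rV[R]_n) k : L x 0 k = \sum_(i < n) x 0 i * L (unit_row R i) 0 k.
  rewrite {1}(row_sum_unit x) linear_sum summxE; apply: eq_bigr => i _.
  by rewrite linearZZ mxE.
have arith (c x l y m : R) : c * (x * l) * (y * m) = x * y * (c * l * m) by ring.
apply/rowP => k; rewrite mxE summxE.
transitivity (\sum_(i < n) \sum_(j < n) \sum_(l < n) \sum_(m < n)
   conn_coef S nabla u q l m k * (a 0 i * L (unit_row R i) 0 l) * (b 0 j * L (unit_row R j) 0 m)).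
  transitivity (\sum_(l < n) \sum_(m < n) \sum_(i < n) \sum_(j < n)
   conn_coef S nabla u q l m k * (a 0 i * L (unit_row R i) 0 l) * (b 0 j * L (unit_row R j) 0 m)).
    apply: eq_bigr => l _; apply: eq_bigr => m _.
    rewrite (LE a) mulr_sumr mulr_suml; apply: eq_bigr => i _.
    by rewrite (LE b) mulr_sumr.
  under eq_bigr => l _ do rewrite exchange_big /=.
  rewrite exchange_big /=; apply: eq_bigr => i _.
  under eq_bigr => l _ do rewrite exchange_big /=.
  by rewrite exchange_big.
apply: eq_bigr => i _; rewrite summxE; apply: eq_bigr => j _.
rewrite !mxE mulr_sumr; apply: eq_bigr => l _; rewrite mulr_sumr; apply: eq_bigr => m _.
exact: arith.
Qed.

Lemma tcoord_change u w q (v : 'rV[R]_n) : atlas S u -> atlas S w ->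
  chart_dom u q -> chart_dom w q ->
  tcoord S w q v = 'd (transition u w) (u q) (tcoord S u q v).
Proof. by move=> au aw uq wq; rewrite -(tcoord_tvec _ au aw uq wq) tcoordK. Qed.

Lemma diff_coord_field_loc u w q j (a : 'rV[R]_n) : atlas S u -> atlas S w ->
  chart_dom u q -> chart_dom w q ->
  'd (field_loc S w (coord_field S u j)) (w q) ('d (transition u w) (u q) a) =
  'd ('D_(unit_row R j) (transition u w)) (u q) a.
Proof.
move=> au aw uq wq; have dwu := transition_differentiable aw au wq uq.
have dDt : differentiable ('D_(unit_row R j) (transition u w)) (transition w u (w q)).
  rewrite transition_map //.
  by apply: ((transition_smooth au aw 2).2 _).1; exact: overlap_map.
have E : 'd (field_loc S w (coord_field S u j)) (w q) =
    'd ('D_(unit_row R j) (transition u w) \o transition w u) (w q) :> (_ -> _).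
  apply: near_eq_diff; last exact: differentiable_comp.
  have : \forall x \near w q, (w @` (chart_dom u `&` chart_dom w)) x.
    by apply: open_nbhs_nbhs; split; [exact: overlap_open|exact: overlap_map].
  by apply: filterS => x wx; rewrite (coord_field_loc j au aw wx).
apply: (etrans (congr1 (@^~ _) E)); apply: (etrans (diff_comp_at _ dwu dDt)).
rewrite (transition_map u wq); congr ('d _ _ _).
by rewrite (diff_transition_comp _ au aw au uq wq uq) diff_transition_id.
Qed.

(** In any chart the bracket is a difference of two mixed second derivatives of
    the transition map. *)
Lemma lie_bracket_coord_field u q i j : atlas S u -> chart_dom u q ->
  lie_bracket S (coord_field S u i) (coord_field S u j) q = 0.
Proof.
move=> au uq; set c := chart_at S q.
have [ac cq] : atlas S c /\ chart_dom c q by split; [exact: chart_at_atlas|exact: chart_at_dom].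
have E a b : 'd (field_loc S c (coord_field S u b)) (c q) (coord_field S u a q) =
    'D_(unit_row R a) ('D_(unit_row R b) (transition u c)) (u q).
  apply: etrans (diff_coord_field_loc b (unit_row R a) au ac uq cq) _.
  apply/esym/deriveE; apply: ((transition_smooth au ac 2).2 _).1; exact: overlap_map.
rewrite /lie_bracket; apply/eqP; rewrite subr_eq0; apply/eqP.
apply: etrans (E i j) _; apply: etrans _ (esym (E j i)).
exact: (@derive_comm_row R _ _ n (transition u c) (u q) (unit_row R i) (unit_row R j) (@overlap_open R n M u c) (overlap_map uq cq) (transition_smooth au ac 2)).
Qed.

(** The covariant derivatives of the coordinate fields of [u], computed in both
    charts; their components in [w] are the first derivatives of the transition
    map, whence the second derivatives. *)
Lemma christoffel_map_change u w q (a b : 'rV[R]_n) : atlas S u -> atlas S w ->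
  chart_dom u q -> chart_dom w q ->
  christoffel_map w q ('d (transition u w) (u q) a) ('d (transition u w) (u q) b) =
  'd (transition u w) (u q) (christoffel_map u q a b) -
  \sum_(j < n) b 0 j *: 'd ('D_(unit_row R j) (transition u w)) (u q) a.
Proof.
move=> au aw uq wq.
have cs i : smooth_field_near S q (coord_field S u i) by exact: coord_field_smooth.
have ce i : tcoord S w q (coord_field S u i q) = 'd (transition u w) (u q) (unit_row R i) by exact: tcoord_tvec.
have key i j : christoffel_map w q ('d (transition u w) (u q) (unit_row R i)) ('d (transition u w) (u q) (unit_row R j)) =
    'd (transition u w) (u q) (tcoord S u q (nabla (coord_field S u i) (coord_field S u j) q)) -
    'd ('D_(unit_row R j) (transition u w)) (u q) (unit_row R i).
  apply/eqP; rewrite eq_sym subr_eq; apply/eqP.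
  apply: etrans (esym (tcoord_change _ au aw uq wq)) _.
  apply: etrans (nabla_chart nablaC aw wq (cs i) (cs j)) _.
  by rewrite !ce addrC; congr (_ + _); exact: diff_coord_field_loc.
rewrite christoffel_map_sum_unit christoffel_mapE.
under eq_bigr => i _ do under eq_bigr => j _ do rewrite key scalerBr.
under eq_bigr => i _ do rewrite sumrB.
rewrite sumrB; congr (_ - _).
  rewrite linear_sum; apply: eq_bigr => i _; rewrite linear_sum; apply: eq_bigr => j _.
  by rewrite linearZZ.
rewrite exchange_big /=; apply: eq_bigr => j _.
rewrite [X in 'd _ _ X]row_sum_unit linear_sum scaler_sumr; apply: eq_bigr => i _.
by rewrite linearZZ scalerA mulrC.
Qed.

Lemma is_derive_scale_row (f : R -> R) (g : R -> 'rV[R]_n) (t df : R) (dg : 'rV[R]_n) :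
  is_derive t 1 f df -> is_derive t 1 g dg ->
  is_derive t 1 (fun s => f s *: g s) (f t *: dg + df *: g t).
Proof.
move=> fd /is_derive_rowP gd; apply/is_derive_rowP => j.
rewrite (_ : (fun s => _) = f * (fun s => g s 0 j)); last first.
  by apply/funext => s; rewrite !mxE.
rewrite (_ : _ 0 j = f t *: dg 0 j + g t 0 j *: df); last first.
  by rewrite !mxE /= [in RHS]/GRing.scale /= [g t 0 j * df]mulrC.
exact: is_deriveM.
Qed.

(** Parallelism is imposed in all charts, but its equation need only be solved in
    one: differentiating the change of components produces second derivatives of
    the transition map that cancel those of [christoffel_map_change]. *)
Lemma parallel_chart_change u w (c : R -> M) (V y : R -> 'rV[R]_n) (t : R) (x' y' : 'rV[R]_n) :
  atlas S u -> atlas S w -> chart_dom u (c t) -> chart_dom w (c t) ->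
  {for t, continuous c} ->
  is_derive t 1 (fun s => u (c s)) x' ->
  (\forall s \near t, y s = tcoord S u (c s) (V s)) ->
  is_derive t 1 y y' ->
  y' + christoffel_map u (c t) x' (y t) = 0 ->
  exists x1 y1, [/\ is_derive t 1 (fun s => w (c s)) x1,
    is_derive t 1 (fun s => tcoord S w (c s) (V s)) y1 &
    y1 + christoffel_map w (c t) x1 (tcoord S w (c t) (V t)) = 0].
Proof.
move=> au aw ut wt cc dx yV dy eq0.
have near_uw : \forall s \near t, chart_dom u (c s) /\ chart_dom w (c s).
  by apply: filterI; apply: cc; apply: open_nbhs_nbhs; split => //; exact: chart_dom_open.
have dtr := transition_differentiable au aw ut wt.
have dDt j : differentiable ('D_(unit_row R j) (transition u w)) (u (c t)).
  by apply: ((transition_smooth au aw 2).2 _).1; exact: overlap_map.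
have yw s : chart_dom u (c s) -> chart_dom w (c s) -> y s = tcoord S u (c s) (V s) ->
    tcoord S w (c s) (V s) = 'd (transition u w) (u (c s)) (y s).
  by move=> us ws ->; exact: tcoord_change.
pose y1 := \sum_(j < n) (y t 0 j *: 'd ('D_(unit_row R j) (transition u w)) (u (c t)) x' +
   y' 0 j *: 'D_(unit_row R j) (transition u w) (u (c t))).
exists ('d (transition u w) (u (c t)) x'), y1; split.
- have := is_derive_comp_curve dx dtr; apply: near_eq_is_derive.
  by apply: filterS near_uw => s [us _]; exact: transition_map.
- have : is_derive t 1 (fun s => \sum_(j < n) y s 0 j *:
       'D_(unit_row R j) (transition u w) (u (c s))) y1.
    apply: (@is_derive_sumE _ _ _ n (fun j s => y s 0 j *:
      'D_(unit_row R j) (transition u w) (u (c s)))) => j.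
    apply: is_derive_scale_row; first by move/is_derive_rowP : dy.
    exact: is_derive_comp_curve dx (dDt j).
  apply: near_eq_is_derive; apply: filterS2 near_uw yV => s [us ws] ys.
  apply: etrans _ (esym (yw s us ws ys)); apply/esym.
  apply: etrans (congr1 _ (row_sum_unit (y s))) _.
  rewrite linear_sum; apply: eq_bigr => j _; rewrite linearZZ; congr (_ *: _).
  exact: (esym (deriveE _ (transition_differentiable au aw us ws))).
- have yVt := nbhs_singleton yV.
  apply: (etrans (congr1 (fun z => y1 + christoffel_map w (c t) _ z) (yw t ut wt yVt))).
  apply: (etrans (congr1 (fun z => y1 + z) (christoffel_map_change x' (y t) au aw ut wt))).
  have cancel (A B C : 'rV[R]_n) : (A + B) + (C - A) = B + C.
    by rewrite addrC addrA subrK addrC.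
  apply: etrans (congr1 (fun z => z + _) (big_split _ _ _ _ _)) _.
  apply: etrans (cancel _ _ _) _.
  apply: etrans _ (linear0 ('d (transition u w) (u (c t)))).
  apply: etrans _ (congr1 _ eq0); rewrite [RHS]linearD; congr (_ + _).
  apply/esym; apply: etrans (congr1 _ (row_sum_unit y')) _.
  rewrite linear_sum; apply: eq_bigr => j _.
  by rewrite linearZZ; congr (_ *: _); exact: (esym (deriveE _ dtr)).
Qed.

Lemma mx_continuous m k (B : R -> 'M[R]_(m, k)) (t : R) :
  (forall i j, {for t, continuous (fun s => B s i j)}) -> {for t, continuous B}.
Proof.
move=> Bc A [P PB sub].
have : \forall s \near t, forall i j, P i j (B s i j).
  apply: (@filter_forall R 'I_m (fun i s => forall j, P i j (B s i j)) (nbhs t) _) => i.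
  apply: (@filter_forall R 'I_k (fun j s => P i j (B s i j)) (nbhs t) _) => j.
  by apply: Bc; exact: PB.
by apply: filterS => s Ps; exact: sub.
Qed.

Lemma smooth_curve_sub (I J : set R) (c : R -> M) : J `<=` I ->
  smooth_curve S I c -> smooth_curve S J c.
Proof.
move=> JI [cc cs]; split=> [t /JI|w aw k]; first exact: cc.
by apply: Ck_on_sub (cs w aw k); exact: setSI.
Qed.

(** In the chart [u], components [y] along the line are parallel when
    [y' = - y *m B t], so the rows of a fundamental matrix [Y] are a parallel
    frame. The inverse [Z] of [Y] gives the components of a coordinate vector in
    this frame. *)
Lemma parallel_frame u (p : M) (a : 'rV[R]_n) : atlas S u -> chart_dom u p -> u p = 0 ->
  smooth_curve S [set t | chart_img u (t *: a)] (fun t => chart_inv u (t *: a)) ->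
  exists (d : R) (Y Z : R -> 'M[R]_n), let c t := chart_inv u (t *: a) in
  let B t := \matrix_(j, k) \sum_(i < n) a 0 i * conn_coef S nabla u (c t) i j k in
  [/\ 0 < d, Y 0 = 1%:M /\ Z 0 = 1%:M,
    (forall i j, is_derive (0 : R) 1 (fun s => Y s i j) (- B 0 i j)) /\
    (forall i j, is_derive (0 : R) 1 (fun s => Z s i j) (B 0 i j)),
    forall t : R, `|t| < d -> Y t *m Z t = 1%:M /\ chart_img u (t *: a) &
    forall (v : 'rV[R]_n) (t : R), `|t| < d ->
      parallel_transport S nabla c 0 t (tvec S u p v) (tvec S u (c t) (v *m Y t))].
Proof.
move=> au up up0 sc.
have u0 : chart_img u 0 by rewrite -up0; exact: chart_img_map.
have c0 : chart_inv u (0 *: a) = p by rewrite scale0r -up0 chart_mapK.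
have linec : continuous (fun t : R => t *: a).
  by move=> t; apply: cvgZr_tmp; exact: cvg_id.
have [r r0 rP] : exists2 r : R, 0 < r & forall t : R, `|t| < r -> chart_img u (t *: a).
  have : \forall t \near (0 : R), chart_img u (t *: a).
    apply: (linec 0); rewrite scale0r.
    by apply: open_nbhs_nbhs; split => //; exact: chart_img_open.
  move=> /nbhs_normP [r /= r0 rP]; exists r => // t tr.
  by apply: rP; rewrite /= sub0r normrN.
pose c t := chart_inv u (t *: a).
pose B t := \matrix_(j, k) \sum_(i < n) a 0 i * conn_coef S nabla u (c t) i j k : 'M[R]_n.
have oball (q : R) : open [set t : R | `|t| < q].
  rewrite (_ : [set t | _] = ball (0 : R) q); first exact: ball_open.
  by apply/seteqP; split => t /=; rewrite -ball_normE /= sub0r normrN.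
have Bc (t : R) : `|t| < r -> {for t, continuous (fun s => - B s)}.
  move=> tr; apply: mx_continuous => j k.
  rewrite (_ : (fun s => _) = fun s => \sum_(i < n) - a 0 i * conn_coef S nabla u (c s) i j k); last first.
    by apply/funext => s; rewrite !mxE -sumrN; apply: eq_bigr => i _; rewrite mulNr.
  apply: (@Ck_on_sum R R R 0 [set t : R | `|t| < r] n
    (fun i s => - a 0 i * conn_coef S nabla u (c s) i j k)) => //.
  move=> i s sr; apply: continuousM; first exact: cst_continuous.
  apply: (@continuous_comp _ _ _ (fun t : R => t *: a)
     (fun x => conn_coef S nabla u (chart_inv u x) i j k)); first exact: linec.
  by apply: conn_coef_continuous => //; exact: rP.
have [d' [Y [Z [d'0 [Y0 Z0] dY dZ YZ]]]] := fundamental_matrix r0 Bc.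
pose d := Num.min d' r.
have d0 : 0 < d by rewrite lt_min d'0.
have dd (t : R) : `|t| < d -> `|t| < d' /\ `|t| < r by rewrite lt_min => /andP[].
have z0 : `|0 : R| < d' by rewrite normr0.
exists d, Y, Z; split => //.
- split=> i j.
    have := dY 0 i j z0; rewrite Y0 mul1mx; congr (is_derive _ _ _ _).
    by rewrite [LHS]mxE.
  have := dZ 0 i j z0; rewrite Z0 mulmx1; congr (is_derive _ _ _ _).
  by rewrite [X in - X]mxE opprK.
- by move=> t /dd [t1 t2]; split; [exact: YZ|exact: rP].
move=> v t td; exists [set t : R | `|t| < d], (fun s => tvec S u (c s) (v *m Y s)); split.
- split; first exact: oball.
  move=> s1 s2 /= + + s /andP[].
  rewrite !ltr_norml => /andP[s1l s1r] /andP[s2l s2r] s1s ss2.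
  by rewrite (lt_le_trans s1l s1s) (le_lt_trans ss2 s2r).
- by rewrite /= normr0.
- by apply: smooth_curve_sub sc => s /= /dd [_ /rP].
- move=> s w /= sd aw ws.
  have [s1 s2] := dd s sd.
  have [us xs] := chart_img_inv (rP s s2).
  have nears : \forall s' \near s, `|s'| < d.
    by apply: open_nbhs_nbhs; split => //; exact: oball.
  have dx : is_derive s 1 (fun s => u (c s)) a.
    have : is_derive s 1 (fun s => 0 + s *: a) a.
      have := @is_derive_line R _ _ id 0 a s (@ex_diff _ _ _ _ _ _ _ (is_diff_id (0 + s *: a))).
      by rewrite derive_id.
    apply: near_eq_is_derive; apply: filterS nears => s' /dd [_ /rP /chart_img_inv [_]].
    by rewrite add0r => ->.
  have dy : is_derive s 1 (fun s => v *m Y s) (- christoffel_map u (c s) a (v *m Y s)).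
    apply/is_derive_rowP => k.
    rewrite (_ : (fun s => _) = fun s => \sum_(i < n) v 0 i * Y s i k); last first.
      by apply/funext => s'; rewrite mxE.
    rewrite (_ : _ 0 k = \sum_(i < n) v 0 i * (Y s *m - B s) i k); last first.
      transitivity ((v *m Y s *m - B s) 0 k); last by rewrite -mulmxA mxE.
      rewrite mulmxN !mxE; congr (- _); rewrite exchange_big /=.
      apply: eq_bigr => j _; rewrite [B s j k]mxE mulr_sumr; apply: eq_bigr => i _.
      by rewrite mulrC; congr (_ * _); rewrite mulrC.
    apply: (@is_derive_sumE _ _ _ n (fun i s => v 0 i * Y s i k)) => i.
    exact: (is_deriveZ (v 0 i) (dY s i k s1)).
  have yV : \forall s' \near s, v *m Y s' = tcoord S u (c s') (tvec S u (c s') (v *m Y s')).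
    apply: filterS nears => s' /dd [_ /rP /chart_img_inv [us' _]].
    by rewrite tvecK.
  have cc : {for s, continuous c} by apply: sc.1 => /=; exact: rP.
  have eq0 : - christoffel_map u (c s) a (v *m Y s) + christoffel_map u (c s) a (v *m Y s) = 0.
    exact: addNr.
  have [x1 [y1 [dx1 dy1 E]]] := parallel_chart_change au aw us ws cc dx yV dy eq0.
  split; first by have [] := dy1.
  move=> k.
  have dxE : derive1 (fun s => w (c s)) s = x1 by rewrite derive1E; case: dx1.
  have dyE : derive1 (fun s => tcoord S w (c s) (tvec S u (c s) (v *m Y s))) s = y1.
    by rewrite derive1E; case: dy1.
  have Ek : (y1 + christoffel_map w (c s) x1 (tcoord S w (c s) (tvec S u (c s) (v *m Y s)))) 0 k = 0.
    by rewrite E mxE.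
  by move: Ek; rewrite [LHS]mxE [X in _ + X = _]mxE -dxE -dyE.
- by rewrite /c c0 Y0 mulmx1.
Qed.

End ParallelTransport.

(** * The fundamental tensor on a fibre *)

Section FinslerFibre.
Context {R : realType} {n : nat} {M : topologicalType}.
Variables (S : smooth_manifold R n M) (F : M -> 'rV[R]_n -> R).
Hypothesis FF : finsler_metric S F.
Implicit Types (p q : M) (v w X Y : 'rV[R]_n).

Lemma nonzero_open : open [set v : 'rV[R]_n | v != 0].
Proof.
rewrite (_ : [set v | _] = ~` [set 0]); last first.
  by apply/seteqP; split => v /=; [move=> /eqP|move=> vn; apply/eqP].
apply/closed_openC/accessible_closed_set1/hausdorff_accessible; exact: norm_hausdorff.
Qed.

Lemma F_loc_chart_at p v : F_loc S F (chart_at S p) (chart_at S p p) v = F p v.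
Proof.
rewrite /F_loc chart_mapK ?/tvec; last exact: chart_at_dom.
by rewrite diff_transition_id //; exact: chart_at_dom.
Qed.

Definition inr_fibre v : 'rV[R]_n * 'rV[R]_n := (0, v).
Fact inr_fibre_linear : linear inr_fibre.
Proof. by move=> a v w; rewrite /inr_fibre; congr pair; rewrite /= scaler0 addr0. Qed.
HB.instance Definition _ := GRing.isLinear.Build R 'rV[R]_n ('rV[R]_n * 'rV[R]_n)%type _
  inr_fibre inr_fibre_linear.

(** [F p] is the restriction of [F], read in a chart, to an affine subspace. *)
Lemma fibre_smooth p : smooth_on [set v | v != 0] (F p).
Proof.
move=> k; set c := chart_at S p.
have := finsler_smooth FF (chart_at_atlas S p) => /(_ k) Fk.
have Fk' : Ck_on k [set v | v != 0] (fun v => F_loc S F c (inr_fibre v + (c p, 0)).1 (inr_fibre v + (c p, 0)).2).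
  apply: (@Ck_on_affine_comp _ _ _ _ k [set v | v != 0] _ inr_fibre (c p, 0)
    (fun z => F_loc S F c z.1 z.2)) Fk.
  - exact: nonzero_open.
  - exact: linear_rV_continuous.
  - move=> v /= v0; rewrite add0r addr0; split => //.
    by apply: chart_img_map; exact: chart_at_dom.
apply: Ck_on_eq Fk'; first exact: nonzero_open.
by move=> v _ /=; rewrite add0r addr0 F_loc_chart_at.
Qed.

Lemma fibre_gt0 p v : v != 0 -> 0 < F p v.
Proof.
move=> v0; rewrite lt_neqAle (finsler_ge0 FF) andbT eq_sym.
by apply: contra_neq v0 => /(finsler_eq0 FF).
Qed.

Lemma energy_smooth p : smooth_on [set v | v != 0] (energy F p).
Proof.
move=> k; apply: (@Ck_on_mul _ _ k _ (fun v => F p v ^+ 2) (fun=> 2^-1)).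
- exact: nonzero_open.
- by apply: Ck_on_mul; [exact: nonzero_open|exact: fibre_smooth|exact: fibre_smooth].
- exact: Ck_on_cst.
Qed.

Lemma derive_sum_unit (f : 'rV[R]_n -> R) v X : differentiable f v ->
  'D_X f v = \sum_(i < n) X 0 i * 'D_(unit_row R i) f v.
Proof.
move=> df; rewrite (deriveE _ df) {1}(row_sum_unit X) linear_sum.
by apply: eq_bigr => i _; rewrite linearZ (deriveE _ df).
Qed.

(** This coordinate-free form makes symmetry and invariance under linear
    isometries consequences of the calculus of second derivatives. *)
Lemma fundE p v X Y : v != 0 -> fund F p v X Y = 'D_X ('D_Y (energy F p)) v.
Proof.
move=> v0.
have dE w : w != 0 -> differentiable (energy F p) w by exact: (energy_smooth p 1).1.
have dDE Z : differentiable ('D_Z (energy F p)) v by exact: ((energy_smooth p 2).2 Z).1.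
have -> : 'D_X ('D_Y (energy F p)) v =
    'D_X (fun w => \sum_(j < n) Y 0 j * 'D_(unit_row R j) (energy F p) w) v.
  apply: near_eq_derive; have : \forall w \near v, w != 0.
    by apply: open_nbhs_nbhs; split => //; exact: nonzero_open.
  by apply: filterS => w w0; rewrite derive_sum_unit //; exact: dE.
have -> : 'D_X (fun w => \sum_(j < n) Y 0 j * 'D_(unit_row R j) (energy F p) w) v =
    \sum_(j < n) Y 0 j * 'D_X ('D_(unit_row R j) (energy F p)) v.
  apply: (@derive_val _ _ _ _ _ _ _ (@is_derive_sumE R _ _ n
    (fun j w => Y 0 j * 'D_(unit_row R j) (energy F p) w)
    (fun j => Y 0 j * 'D_X ('D_(unit_row R j) (energy F p)) v) v X _)) => j.
  exact/is_deriveZ/derivableP/diff_derivable.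
rewrite /fund exchange_big /=; apply: eq_bigr => j _.
rewrite (derive_sum_unit X (dDE (unit_row R j))) mulr_sumr; apply: eq_bigr => i _.
by rewrite [RHS]mulrC; congr (_ * _); rewrite [RHS]mulrC; congr (_ * _); exact: mxE.
Qed.

Lemma fund_sym p v X Y : v != 0 -> fund F p v X Y = fund F p v Y X.
Proof.
move=> v0; apply: etrans (fundE p X Y v0) _; apply: etrans _ (esym (fundE p Y X v0)).
exact: derive_comm nonzero_open v0 (energy_smooth p 2).
Qed.

Lemma fund_lin p v (a : R) X X' Y :
  fund F p v (a *: X + X') Y = a * fund F p v X Y + fund F p v X' Y.
Proof.
rewrite /fund mulr_sumr -big_split; apply: eq_bigr => i _ /=.
rewrite mulr_sumr -big_split; apply: eq_bigr => j _ /=.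
by rewrite !mxE; ring.
Qed.

Lemma fund_linr p v (a : R) X Y Y' :
  fund F p v X (a *: Y + Y') = a * fund F p v X Y + fund F p v X Y'.
Proof.
rewrite /fund mulr_sumr -big_split; apply: eq_bigr => i _ /=.
rewrite mulr_sumr -big_split; apply: eq_bigr => j _ /=.
by rewrite !mxE; ring.
Qed.

Lemma fund_continuous p X Y v : v != 0 -> {for v, continuous (fun w => fund F p w X Y)}.
Proof.
move=> v0.
have c2 : Ck_on 0 [set w : 'rV[R]_n | w != 0] ('D_X ('D_Y (energy F p))).
  exact: ((energy_smooth p 2).2 Y).2.
suff : Ck_on 0 [set w : 'rV[R]_n | w != 0] (fun w => fund F p w X Y) by apply.
by apply: Ck_on_eq nonzero_open _ c2 => w w0; rewrite fundE.
Qed.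

Lemma derive_comp_linear (A : {linear 'rV[R]_n -> 'rV[R]_n}) (f : 'rV[R]_n -> R) v X :
  differentiable f (A v) -> 'D_X (fun w => f (A w)) v = 'D_(A X) f (A v).
Proof.
move=> df; have Ac : continuous A by exact: linear_rV_continuous.
have dA : differentiable A v by exact: linear_differentiable.
have dfA : differentiable (f \o A) v by exact: differentiable_comp.
apply: etrans (deriveE _ dfA) _; apply: etrans (diff_comp_at _ dA df) _.
by rewrite diff_lin // deriveE.
Qed.

Lemma fund_isometry p q (A : {linear 'rV[R]_n -> 'rV[R]_n}) v X Y :
  (forall w, F q (A w) = F p w) -> v != 0 ->
  fund F q (A v) (A X) (A Y) = fund F p v X Y.
Proof.
move=> AF v0.
have A0 w : w != 0 -> A w != 0.
  apply: contra_neq => Aw0; apply/(finsler_eq0 FF p); rewrite -AF Aw0.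
  exact/(finsler_eq0 FF).
apply: etrans (fundE q (A X) (A Y) (A0 v v0)) _; apply: etrans _ (esym (fundE p X Y v0)).
have EA : energy F p = (fun w => energy F q (A w)).
  by apply/funext => w; rewrite /energy AF.
have dE w : w != 0 -> differentiable (energy F q) w by exact: (energy_smooth q 1).1.
have dDE : differentiable ('D_(A Y) (energy F q)) (A v).
  by apply: ((energy_smooth q 2).2 _).1; exact: A0.
apply: etrans (esym (derive_comp_linear X dDE)) _; apply: near_eq_derive.
have : \forall w \near v, w != 0.
  by apply: open_nbhs_nbhs; split => //; exact: nonzero_open.
apply: filterS => w w0; rewrite EA; apply/esym/derive_comp_linear.
by apply: dE; exact: A0.
Qed.

End FinslerFibre.

Lemma diff_affine {R : realType} (V W : normedModType R) (L : {linear V -> W}) (b : W) (x h : V) :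
  continuous L -> 'd (fun z => L z + b) x h = L h.
Proof.
move=> Lc; have dL : differentiable L x by exact: linear_differentiable.
have E : 'd (fun z => L z + b) x = 'd L x \+ 'd (cst b) x :> (_ -> _).
  exact: diffD dL (differentiable_cst _ _).
by rewrite E diff_cst /= addr0 diff_lin.
Qed.

(** * Radial parametrizations of the indicatrix *)

Section RadialParametrization.
Context {R : realType} {m : nat} {M : topologicalType}.
Variables (S : smooth_manifold R m.+1 M) (F : M -> 'rV[R]_m.+1 -> R).
Hypothesis FF : finsler_metric S F.
Variable p : M.
Implicit Types (k : 'I_m.+1) (e : R) (s : 'rV[R]_m).

(** Insertion of a zero at the [k]-th place. *)
Definition face_emb k s : 'rV[R]_m.+1 := s *m row' k 1%:M.
Fact face_emb_linear k : linear (face_emb k).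
Proof. by move=> a x y; rewrite /face_emb mulmxDl scalemxAl. Qed.
HB.instance Definition _ k := GRing.isLinear.Build R 'rV[R]_m 'rV[R]_m.+1 _
  (face_emb k) (face_emb_linear k).

Lemma face_emb_lift k s j : face_emb k s 0 (lift k j) = s 0 j.
Proof.
rewrite mxE (bigD1 j) //= !mxE eqxx mulr1 big1 ?addr0 // => i ij.
by rewrite !mxE (inj_eq (@lift_inj _ k)) (negbTE ij) mulr0.
Qed.

Lemma face_emb_at k s : face_emb k s 0 k = 0.
Proof. by rewrite mxE big1 // => i _; rewrite !mxE eq_sym (negbTE (neq_lift _ _)) mulr0. Qed.

(** The points with [k]-th coordinate [e] form an affine hyperplane off the
    origin; radial projection sends it to the indicatrix. *)
Definition face k e s : 'rV[R]_m.+1 := face_emb k s + e *: unit_row R k.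

Lemma face_at k e s : face k e s 0 k = e.
Proof. by rewrite /face [LHS]mxE face_emb_at add0r !mxE !eqxx mulr1. Qed.

Lemma face_lift k e s j : face k e s 0 (lift k j) = s 0 j.
Proof.
by rewrite /face [LHS]mxE face_emb_lift !mxE eq_sym (negbTE (neq_lift _ _)) mulr0 addr0.
Qed.

Lemma face_neq0 k e s : e != 0 -> face k e s != 0.
Proof. by apply: contra_neq => f0; rewrite -(face_at k e s) f0 mxE. Qed.

Definition radial k e s : 'rV[R]_m.+1 := (F p (face k e s))^-1 *: face k e s.

Lemma radial_image k e : (e == 1) || (e == -1) ->
  radial k e @` setT = indicatrix F p `&` [set v | 0 < e * v 0 k].
Proof.
move=> e1; have ee : e * e = 1.
  by case/orP: e1 => /eqP ->; rewrite ?mulr1 // mulrNN mulr1.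
have e0 : e != 0 by apply/eqP => e0; move: ee; rewrite e0 mul0r => /esym/eqP; rewrite oner_eq0.
apply/seteqP; split => [_ [s _ <-]|v [Fv /= ev]].
  have Ff := fibre_gt0 FF p (face_neq0 k s e0).
  split; rewrite /indicatrix /radial /=.
    by rewrite (finsler_homogeneous FF) ?invr_gt0 // mulVf // gt_eqF.
  by rewrite mxE face_at mulrCA ee mulr1 invr_gt0.
have v0 : v 0 k != 0 by apply: contraL ev => /eqP ->; rewrite mulr0 ltxx.
pose c := (e * v 0 k)^-1; have c0 : 0 < c by rewrite invr_gt0.
exists (\row_j (c * v 0 (lift k j))) => //.
have fE : face k e (\row_j (c * v 0 (lift k j))) = c *: v.
  apply/rowP => j; case: (unliftP k j) => [j' ->|->].
    by rewrite face_lift !mxE.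
  rewrite face_at mxE /c invfM mulfVK //.
  by apply: (mulfI e0); rewrite ee divff.
rewrite /radial fE (finsler_homogeneous FF) // Fv mulr1 scalerA mulVf ?scale1r //.
by rewrite gt_eqF.
Qed.

Lemma face_smooth k e d : Ck_on d setT (face k e).
Proof.
apply: (@Ck_on_affine_comp _ _ _ _ d setT setT (face_emb k) (e *: unit_row R k) id) => //.
- exact: openT.
- exact: linear_rV_continuous.
- by apply: (@Ck_on_linear _ _ _ d setT idfun) => x; exact: cvg_id.
Qed.

Definition radial_factor k e s : R := (F p (face k e s))^-1.

Lemma radial_factor_smooth k e d : e != 0 -> Ck_on d setT (radial_factor k e).
Proof.
move=> e0; apply: Ck_on_inv; first exact: openT.
  by move=> s _; rewrite gt_eqF // (fibre_gt0 FF) // face_neq0.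
apply: (@Ck_on_comp_scalar _ _ d setT _ [set v | v != 0] (face k e)).
- exact: openT.
- by move=> s _; exact: face_neq0.
- exact: face_smooth.
- exact: (fibre_smooth FF p d).
Qed.

Lemma radial_smooth k e : e != 0 -> smooth_on setT (radial k e).
Proof.
move=> e0 d; apply: Ck_on_row; first exact: openT.
move=> j; apply: (@Ck_on_eq _ _ _ d _ (fun s => (F p (face k e s))^-1 * face k e s 0 j)).
- exact: openT.
- by move=> s _; rewrite [RHS]mxE.
apply: Ck_on_mul; [exact: openT|exact: radial_factor_smooth|].
by apply: Ck_on_coord; [exact: openT|exact: face_smooth].
Qed.

(** The product rule for the factor [1 / F] times the affine map [face]. *)
Lemma radial_diff k e s (h : 'rV[R]_m) j : e != 0 ->
  ('d (radial k e) s h : 'rV[R]_m.+1) 0 j =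
  radial_factor k e s * face_emb k h 0 j + face k e s 0 j * ('d (radial_factor k e) s h : R).
Proof.
move=> e0; have ds : differentiable (radial k e) s by exact: (radial_smooth k e0 1).1.
have dg : differentiable (radial_factor k e) s.
  exact: (radial_factor_smooth k 1 e0).1.
have df : differentiable (face k e) s by exact: (face_smooth k e 1).1.
have dfE : 'd (face k e) s h = face_emb k h.
  exact: (diff_affine (e *: unit_row R k) s h (@linear_rV_continuous R m _ (face_emb k))).
have cc := @linear_rV_continuous R m.+1 _ (@coordL R m.+1 j).
have dfj : differentiable (fun s => face k e s 0 j) s by exact: (@differentiable_linear_comp _ _ _ _ (@coordL R m.+1 j)).
have -> : 'd (radial k e) s h 0 j = 'd (fun s => coordL j (radial k e s)) s h.
  exact: (esym (congr1 (@^~ h) (@diff_linear_comp _ _ _ _ (@coordL R m.+1 j) _ _ cc ds))).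
have -> : face_emb k h 0 j = 'd (fun s => face k e s 0 j) s h.
  apply: etrans (congr1 (fun v : 'rV[R]_m.+1 => v 0 j) (esym dfE)) _.
  exact: (esym (congr1 (@^~ h) (@diff_linear_comp _ _ _ _ (@coordL R m.+1 j) _ _ cc df))).
rewrite (_ : (fun s => coordL j _) = (radial_factor k e) * (fun s => face k e s 0 j)).
  exact: (congr1 (@^~ h) (diffM dg dfj)).
by apply/funext => t; rewrite /coordL [LHS]mxE.
Qed.

(** The [k]-th coordinate of [radial] is [e] times the factor [1 / F]. Along a
    vector of the kernel this factor therefore has zero derivative, and then the
    other coordinates show that the vector vanishes. *)
Lemma radial_row_free k e s : e != 0 -> row_free (lin1_mx ('d (radial k e) s)).
Proof.
move=> e0; have Fn0 : F p (face k e s) != 0 by rewrite gt_eqF // (fibre_gt0 FF) // face_neq0.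
apply: inj_row_free => h; rewrite mul_rV_lin1 /= => dh.
have dgh : ('d (radial_factor k e) s h : R) = 0.
  have := radial_diff k s h k e0; rewrite dh mxE face_emb_at mulr0 add0r face_at => /esym/eqP.
  by rewrite mulf_eq0 (negbTE e0) => /eqP.
apply/rowP => j; have := radial_diff k s h (lift k j) e0.
rewrite dh dgh mulr0 addr0 mxE face_emb_lift => /esym/eqP.
by rewrite mulf_eq0 invr_eq0 (negbTE Fn0) => /eqP ->; rewrite mxE.
Qed.

Lemma radial_param k e : (e == 1) || (e == -1) ->
  indicatrix_param F p setT (radial k e).
Proof.
move=> e1; have e0 : e != 0.
  by case/orP: e1 => /eqP ->; rewrite ?oppr_eq0 oner_eq0.
have Fn0 s : F p (face k e s) != 0 by rewrite gt_eqF // (fibre_gt0 FF) // face_neq0.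
split.
- exact: openT.
- exact: radial_smooth.
- move=> s t _ _ st.
  have Fst : (F p (face k e s))^-1 = (F p (face k e t))^-1.
    have := congr1 (fun v : 'rV[R]_m.+1 => v 0 k) st.
    by rewrite /= ![radial _ _ _ _ _]mxE !face_at => /(mulIf e0).
  apply/rowP => j; have := congr1 (fun v : 'rV[R]_m.+1 => v 0 (lift k j)) st.
  rewrite /= ![radial _ _ _ _ _]mxE !face_lift Fst.
  by apply: mulfI; rewrite invr_eq0.
- by move=> s _; exact: radial_row_free.
- move=> s _; rewrite /indicatrix /= /radial (finsler_homogeneous FF) ?mulVf //.
  by rewrite invr_gt0 (fibre_gt0 FF) // face_neq0.
Qed.

End RadialParametrization.

(** * Uniqueness and invariance of the volume of the indicatrix *)

Section BorelRow.
Context {R : realType} {n : nat}.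

Lemma open_halfspace (e : R) (k : 'I_n) : open [set v : 'rV[R]_n | 0 < e * v 0 k].
Proof.
rewrite openE => v /= v0.
have cf : {for v, continuous (fun w => e * coordL k w)}.
  apply: differentiable_continuous; apply: differentiableM.
    exact: differentiable_cst.
  by apply: linear_differentiable; exact: linear_rV_continuous.
exact: (cvgr_gt _ cf 0 v0).
Qed.

Local Notation T := (borel_rV R n).

Lemma open_measurable_rV (U : set 'rV[R]_n) : open U -> measurable (U : set T).
Proof. by move=> oU; apply: sub_sigma_algebra. Qed.

Lemma continuous_measurable_rV (A : 'rV[R]_n -> 'rV[R]_n) : continuous A ->
  measurable_fun setT (A : T -> T).
Proof.
move=> Ac; apply: (@measurability _ _ T T setT A (@open 'rV[R]_n)) => //.
move=> _ [U oU <-]; rewrite setTI; apply: open_measurable_rV.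
by move: Ac => /continuousP; apply.
Qed.

Lemma measurable_fun_continuous_on (D : set T) (O : set 'rV[R]_n) (f : 'rV[R]_n -> R) :
  measurable D -> open O -> D `<=` O -> (forall v, O v -> {for v, continuous f}) ->
  measurable_fun D (f : T -> R).
Proof.
move=> mD oO DO fc; apply: (measurability _ (RGenOInfty.measurableE R)).
move=> _ [_ [a ->] <-].
rewrite (_ : D `&` _ = D `&` (O `&` f @^-1` `]a, +oo[%classic)); last first.
  by rewrite setIA (setIidl DO).
apply: measurableI => //; apply: open_measurable_rV.
rewrite openE => v [Ov fv]; apply: filterI; first exact: open_nbhs_nbhs.
by apply: (fc v Ov); apply: open_nbhs_nbhs; split => //; exact: itv_open.
Qed.

End BorelRow.

Section MeasurePushforward.
Local Open Scope ereal_scope.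
Context {d d' : measure_display} {T1 : measurableType d} {T2 : measurableType d'} {R : realType}.
Variables (f : T1 -> T2) (mf : measurable_fun [set: T1] f) (mu : {measure set T1 -> \bar R}).

(** The proof of measurability is an argument here, so that the measure
    structure can be inferred from the term. *)
Definition measure_image of measurable_fun [set: T1] f : set T2 -> \bar R := pushforward mu f.

Local Notation image := (measure_image mf).

Let image0 : image set0 = 0. Proof. exact: measure0. Qed.

Let image_ge0 B : 0 <= image B. Proof. exact: measure_ge0. Qed.

Let image_sigma_additive : semi_sigma_additive image.
Proof. exact: measure_semi_sigma_additive. Qed.

HB.instance Definition _ := isMeasure.Build _ _ _ image image0 image_ge0 image_sigma_additive.

End MeasurePushforward.

Section IndicatrixVolume.
Context {R : realType} {m : nat} {M : topologicalType}.
Local Notation n := m.+1.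
Variables (S : smooth_manifold R n M) (F : M -> 'rV[R]_n -> R).
Hypothesis FF : finsler_metric S F.
Local Notation T := (borel_rV R n).
Implicit Types (p q : M) (v w X Y : 'rV[R]_n).

Lemma indicatrix_neq0 p v : indicatrix F p v -> v != 0.
Proof.
rewrite /indicatrix /= => Fv; apply: contra_eq_neq Fv => ->.
by rewrite ((finsler_eq0 FF p 0).2 erefl) eq_sym oner_eq0.
Qed.

Lemma fibre_continuous p : continuous (F p).
Proof.
move=> v; set c := chart_at S p.
have cc := finsler_continuous FF (chart_at_atlas S p).
have hc : chart_img c (c p) by apply: chart_img_map; exact: chart_at_dom.
have := cc (c p, v) hc; rewrite /continuous_at /= => Fc.
rewrite (_ : F p = (fun z => F_loc S F c z.1 z.2) \o (fun w => (c p, w))); last first.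
  by apply/funext => w /=; rewrite F_loc_chart_at.
apply: continuous_comp; last exact: Fc.
by apply: differentiable_continuous; exact: (@differentiable_pair _ _ _ _ (cst (c p)) id).
Qed.

Lemma indicatrix_measurable p : measurable (indicatrix F p : set T).
Proof.
rewrite -[indicatrix F p]setCK; apply: measurableC; apply: open_measurable_rV.
rewrite (_ : ~` _ = F p @^-1` (~` [set 1])) //.
have := (@fibre_continuous p); move/continuousP; apply.
exact/closed_openC/accessible_closed_set1/hausdorff_accessible/norm_hausdorff.
Qed.

Let sgn (b : bool) : R := if b then 1 else -1.
Let sgnP b : (sgn b == 1) || (sgn b == -1).
Proof. by case: b; rewrite /sgn eqxx ?orbT. Qed.

(** Open coordinate half-spaces cut the indicatrix into the images of the radial
    parametrizations. *)
Let piece p (i : 'I_n * bool) : set T := indicatrix F p `&` [set v | 0 < sgn i.2 * v 0 i.1].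

Let piece_measurable p i : measurable (piece p i).
Proof.
apply: measurableI; first exact: indicatrix_measurable.
apply: open_measurable_rV.
exact: open_halfspace.
Qed.

Let piece_cover p v : indicatrix F p v -> exists i, piece p i v.
Proof.
move=> Fv; have /rV0Pn[k vk] := indicatrix_neq0 Fv.
have [vk0|vk0|vk0] := ltgtP (v 0 k) 0.
- by exists (k, false); split => //=; rewrite mulN1r oppr_gt0.
- by exists (k, true); split => //=; rewrite mul1r.
- by rewrite vk0 eqxx in vk.
Qed.

(** The indicatrix is covered by finitely many parametrized pieces, on each of
    which the measure is prescribed; making the pieces disjoint one by one extends
    the equality to their union. *)
Lemma indicatrix_volume_unique p (mu nu : {measure set T -> \bar R}) :
  indicatrix_volume F p mu -> indicatrix_volume F p nu ->
  forall A : set T, measurable A -> mu A = nu A.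
Proof.
move=> [mu0 muP] [nu0 nuP].
have onpiece i (A : set T) : measurable A -> mu (A `&` piece p i) = nu (A `&` piece p i).
  move=> mA; have prm := radial_param FF p i.1 (sgnP i.2).
  by rewrite /piece -(radial_image FF p i.1 (sgnP i.2)) (muP _ _ prm _ mA) (nuP _ _ prm _ mA).
have onunion (r : seq ('I_n * bool)) (A : set T) : measurable A ->
    mu (A `&` \big[setU/set0]_(i <- r) piece p i) = nu (A `&` \big[setU/set0]_(i <- r) piece p i).
  elim: r A => [|i r IH] A mA; first by rewrite big_nil setI0 !measure0.
  have mU : measurable (\big[setU/set0]_(i <- r) piece p i : set T).
    by apply: bigsetU_measurable => j _; exact: piece_measurable.
  have mi := piece_measurable p i.
  have -> : A `&` \big[setU/set0]_(i <- i :: r) piece p i =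
      (A `&` piece p i) `|` ((A `\` piece p i) `&` \big[setU/set0]_(i <- r) piece p i).
    rewrite big_cons; apply/seteqP; split=> v.
      move=> [Av [iv|rv]]; first by left.
      by have [iv|niv] := pselect (piece p i v); [left|right].
    by move=> [[Av iv]|[[Av _] rv]]; split => //; [left|right].
  have dis : (A `&` piece p i) `&` ((A `\` piece p i) `&` \big[setU/set0]_(i <- r) piece p i) = set0.
    by apply/seteqP; split => v // [[_ iv] [[_]]].
  have mA1 : measurable (A `&` piece p i) by exact: measurableI.
  have mA2 : measurable (A `\` piece p i) by exact: measurableD.
  have mA3 : measurable ((A `\` piece p i) `&` \big[setU/set0]_(i <- r) piece p i) by exact: measurableI.
  rewrite !measureU //; congr (_ + _)%E; [exact: onpiece|exact: IH].
move=> A mA.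
have cut (k : {measure set T -> \bar R}) : k (~` indicatrix F p) = 0%E ->
    k A = k (A `&` \big[setU/set0]_(i <- enum {: 'I_n * bool}) piece p i).
  move=> k0; have mS := indicatrix_measurable p.
  have US : \big[setU/set0]_(i <- enum {: 'I_n * bool}) piece p i = indicatrix F p.
    rewrite -bigcup_seq; apply/seteqP; split => [v [i _ []] //|v /piece_cover[i vi]].
    by exists i => //=; rewrite mem_enum.
  rewrite US (measureDI k mA mS) -[RHS]add0e; congr (_ + _)%E.
  apply/eqP; rewrite eq_le measure_ge0 andbT -k0; apply: le_measure.
  - by rewrite inE; exact: measurableD.
  - by rewrite inE; exact: measurableC.
  - by move=> v [].
by rewrite (cut _ mu0) (cut _ nu0) onunion.
Qed.

Variables (p q : M) (A A' : {linear 'rV[R]_n -> 'rV[R]_n}).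
Hypothesis AK : cancel A A'.
Hypothesis A'K : cancel A' A.
Hypothesis AF : forall w, F q (A w) = F p w.

Let Ac : continuous A. Proof. exact: linear_rV_continuous. Qed.
Let A'c : continuous A'. Proof. exact: linear_rV_continuous. Qed.
Let mA : measurable_fun setT (A : T -> T). Proof. exact: continuous_measurable_rV. Qed.

Let A'F w : F p (A' w) = F q w.
Proof. by rewrite -AF A'K. Qed.

Lemma jacobian_linear_comp (sigma : 'rV[R]_m -> 'rV[R]_n) s : differentiable sigma s ->
  forall h, h *m 'J (fun s => A' (sigma s)) s = A' (h *m 'J sigma s).
Proof.
move=> ds h; apply: etrans (mul_rV_lin1 _ _) _.
apply: etrans _ (esym (congr1 A' (mul_rV_lin1 _ _))).
exact: (congr1 (@^~ h) (@diff_linear_comp _ _ _ _ A' _ _ A'c ds)).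
Qed.

Lemma indicatrix_param_isometry D (sigma : 'rV[R]_m -> 'rV[R]_n) :
  indicatrix_param F q D sigma -> indicatrix_param F p D (fun s => A' (sigma s)).
Proof.
move=> [oD ss si sr sF]; split.
- exact: oD.
- by move=> k; exact: (Ck_on_linear_comp oD A'c (ss k)).
- by move=> s t Ds Dt st; apply: (si s t Ds Dt); exact: (can_inj A'K st).
- move=> s Ds; apply: inj_row_free => h.
  move=> h0; have A'h : A' (h *m 'J sigma s) = A' 0.
    rewrite linear0 -h0; apply/esym/jacobian_linear_comp.
    exact: ((ss 1%N).1 s Ds).
  have hJ := can_inj A'K A'h.
  by apply: (row_free_inj (sr _ Ds)); rewrite hJ mul0mx.
- by move=> s Ds; apply: etrans (A'F _) _; exact: (sF s Ds).
Qed.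

(** [A'] is linear, so it maps the rows of the Jacobian matrix to those of the
    composite, and the fundamental tensor does not change along it. *)
Lemma indicatrix_density_isometry D (sigma : 'rV[R]_m -> 'rV[R]_n) s :
  indicatrix_param F q D sigma -> D s ->
  indicatrix_density F p (fun s => A' (sigma s)) s = indicatrix_density F q sigma s.
Proof.
move=> [oD ss si sr sF] Ds.
have ds : differentiable sigma s by exact: ((ss 1%N).1 s Ds).
have rowJ a : row a ('J (fun s => A' (sigma s)) s) = A' (row a ('J sigma s)).
  apply: etrans (rowE a _) _; apply: etrans (jacobian_linear_comp ds _) _.
  exact: (congr1 A' (esym (rowE a _))).
have E : (\matrix_(a < m, b < m) fund F p (A' (sigma s)) (row a ('J (fun s => A' (sigma s)) s))
    (row b ('J (fun s => A' (sigma s)) s)) : 'M[R]_m) =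
  \matrix_(a < m, b < m) fund F q (sigma s) (row a ('J sigma s)) (row b ('J sigma s)).
  apply/matrixP => a b; apply: etrans (mxE _ _ _ _) _; apply: etrans _ (esym (mxE _ _ _ _)).
  apply: etrans (congr2 (fund F p (A' (sigma s))) (rowJ a) (rowJ b)) _.
  by apply: (fund_isometry FF _ _ A'F); exact: (indicatrix_neq0 (sF s Ds)).
exact: (congr1 (fun N : 'M[R]_m => Num.sqrt (\det N)) E).
Qed.

(** Composition with [A'] turns a parametrization of the indicatrix at [q] into
    one at [p] with the same density. *)
Lemma indicatrix_volume_pushforward (mu : {measure set T -> \bar R}) :
  indicatrix_volume F p mu -> indicatrix_volume F q (measure_image mu mA).
Proof.
move=> [mu0 muP]; split.
  have preS : A @^-1` (~` indicatrix F q) = ~` indicatrix F p.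
    by apply/seteqP; split=> v /=; rewrite /indicatrix /= AF.
  exact: etrans (congr1 mu preS) mu0.
move=> D sigma prm B mB; have prm' := indicatrix_param_isometry prm.
have mAB : measurable (A @^-1` B : set T) by rewrite -[X in measurable X]setTI; exact: mA.
have preBD : A @^-1` (B `&` sigma @` D) = A @^-1` B `&` (fun s => A' (sigma s)) @` D.
  apply/seteqP; split => v /=.
    by move=> [Bv [s Ds sv]]; split => //; exists s => //; rewrite sv AK.
  by move=> [Bv [s Ds sv]]; split => //; exists s => //; rewrite -sv A'K.
have preB : (fun s => A' (sigma s)) @^-1` (A @^-1` B) = sigma @^-1` B.
  by apply/seteqP; split => t /=; rewrite A'K.
have fE (s : 'rV[R]_m) : \1_(D `&` (fun s => A' (sigma s)) @^-1` (A @^-1` B)) s *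
      indicatrix_density F p (fun s => A' (sigma s)) s =
    \1_(D `&` sigma @^-1` B) s * indicatrix_density F q sigma s.
  rewrite preB indicE; case: (boolP (s \in D `&` sigma @^-1` B)) => [/set_mem [Ds _]|_].
    by rewrite (indicatrix_density_isometry prm Ds).
  exact: etrans (mul0r _) (esym (mul0r _)).
apply: etrans (congr1 mu preBD) _; apply: etrans (muP _ _ prm' _ mAB) _.
exact: (congr1 (@lebesgue_iint R m) (funext (fun s => congr1 EFin (fE s)))).
Qed.

(** The change of variables is made separately for the positive and the negative
    part, so that integrability is not at stake. *)
Lemma integral_indicatrix_isometry (mu nu : {measure set T -> \bar R}) X Y :
  indicatrix_volume F p mu -> indicatrix_volume F q nu ->
  (\int[nu]_(v in indicatrix F q) fund F q v (A X) (A Y))%R =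
  (\int[mu]_(v in indicatrix F p) fund F p v X Y)%R.
Proof.
move=> muV nuV; rewrite /Rintegral; congr fine.
have mSq := indicatrix_measurable q.
have mf : measurable_fun (indicatrix F q : set T) (fun v : T => (fund F q v (A X) (A Y))%:E).
  apply/measurable_EFinP.
  apply: (@measurable_fun_continuous_on _ _ _ [set v | v != 0]) => //.
  - exact: nonzero_open.
  - by move=> v; exact: indicatrix_neq0.
  - by move=> v; exact: (fund_continuous FF).
have eqm : forall B : set T, measurable B -> B `<=` indicatrix F q ->
    nu B = measure_image mu mA B.
  move=> B mB _; exact: (indicatrix_volume_unique nuV (indicatrix_volume_pushforward muV)).
have preS : A @^-1` indicatrix F q = indicatrix F p.
  by apply/seteqP; split=> v /=; rewrite /indicatrix /= AF.
have fE v : indicatrix F p v -> fund F q (A v) (A X) (A Y) = fund F p v X Y.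
  by move=> Sv; apply: (fund_isometry FF) => //; exact: (indicatrix_neq0 Sv).
rewrite (eq_measure_integral (measure_image mu mA) eqm).
rewrite integralE [RHS]integralE; congr (_ - _)%E.
  apply: etrans (ge0_integral_pushforward mA mu mSq (measurable_funepos mf) _) _.
    by move=> v _; exact: funepos_ge0.
  rewrite preS; apply: eq_integral => v /set_mem Sv /=.
  by rewrite !funeposE fE.
apply: etrans (ge0_integral_pushforward mA mu mSq (measurable_funeneg mf) _) _.
  by move=> v _; exact: funeneg_ge0.
rewrite preS; apply: eq_integral => v /set_mem Sv /=.
by rewrite !funenegE fE.
Qed.

End IndicatrixVolume.

(** * The averaged metric *)

Lemma scalar_sum {R : realType} n k (g : 'rV[R]_n -> R) (c : 'I_k -> R) (b : 'I_k -> 'rV[R]_n) :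
  (forall a x y, g (a *: x + y) = a * g x + g y) ->
  g (\sum_(i < k) c i *: b i) = \sum_(i < k) c i * g (b i).
Proof.
move=> gl; elim: k c b => [|k IH] c b; last by rewrite !big_ord_recl gl IH.
rewrite !big_ord0; have := gl 1 0 0; rewrite scale1r addr0 mul1r => /eqP.
by rewrite -subr_eq subrr eq_sym => /eqP.
Qed.

Section AveragedMetric.
Context {R : realType} {m : nat} {M : topologicalType}.
Local Notation n := m.+1.
Variables (S : smooth_manifold R n M) (F : M -> 'rV[R]_n -> R).
Hypothesis FF : finsler_metric S F.
Variable gamma : M -> 'rV[R]_n -> 'rV[R]_n -> R.
Hypothesis gammaF : averaged_metric F gamma.
Local Notation T := (borel_rV R n).

(** A linear isometry between the fibres carries one indicatrix volume to the
    other. *)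
Lemma averaged_metric_isometry_succ p q (A A' : {linear 'rV[R]_n -> 'rV[R]_n}) :
  cancel A A' -> cancel A' A -> (forall w, F q (A w) = F p w) ->
  forall X Y, gamma q (A X) (A Y) = gamma p X Y.
Proof.
move=> AK A'K AF X Y; have [mu muV muE] := gammaF p; have [nu nuV nuE] := gammaF q.
apply: etrans (nuE _ _) _; apply: etrans _ (esym (muE _ _)).
exact: (integral_indicatrix_isometry FF AK A'K AF X Y muV nuV).
Qed.

Lemma fund_ge0 p v X : v != 0 -> 0 <= fund F p v X X.
Proof.
move=> v0; have [->|X0] := eqVneq X 0; last exact/ltW/(finsler_posdef FF).
rewrite /fund big1 // => i _; rewrite big1 // => j _.
by rewrite !mxE !mulr0.
Qed.

(** Polarization: the form is nonnegative at [X + Y] and at [Y - X]. *)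
Lemma fund_normr_le p v X Y : v != 0 -> `|fund F p v X Y| <= fund F p v X X + fund F p v Y Y.
Proof.
move=> v0; have sym := fund_sym FF p X Y v0.
have XX := fund_ge0 p X v0; have YY := fund_ge0 p Y v0.
have P := fund_ge0 p (1 *: X + Y) v0; have N := fund_ge0 p (-1 *: X + Y) v0.
move: P N; rewrite !fund_lin !fund_linr -sym => P N; rewrite ler_norml; lra.
Qed.

Lemma Rintegral_lincomb (mu : {measure set T -> \bar R}) (D : set T) k (c : 'I_k -> R)
    (f : 'I_k -> T -> R) : measurable D ->
  (forall i, mu.-integrable D (EFin \o f i)) ->
  mu.-integrable D (EFin \o (fun v => \sum_(i < k) c i * f i v)) /\
  (\int[mu]_(v in D) (\sum_(i < k) c i * f i v) =
   \sum_(i < k) c i * \int[mu]_(v in D) f i v)%R.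
Proof.
move=> mD; elim: k c f => [|k IH] c f fi.
  rewrite big_ord0 (_ : (fun v => _) = cst 0); last first.
    by apply/funext => v; rewrite big_ord0.
  split; first exact: integrable0.
  by rewrite Rintegral_cst // mul0r.
have [Ii IE] := IH (fun i => c (lift ord0 i)) (fun i => f (lift ord0 i)) (fun i => fi _).
have I0 : mu.-integrable D (EFin \o (fun v => c ord0 * f ord0 v)).
  by have := integrableZl mD (c ord0) (fi ord0).
have E : (fun v => \sum_(i < k.+1) c i * f i v) =
    (fun v => c ord0 * f ord0 v + \sum_(i < k) c (lift ord0 i) * f (lift ord0 i) v).
  by apply/funext => v; rewrite big_ord_recl.
rewrite E; split; first by have := integrableD mD I0 Ii.
apply: etrans (RintegralD mD I0 Ii) _.
by rewrite (RintegralZl _ mD (fi ord0)) big_ord_recl IE.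
Qed.

(** Bilinearity of the averaged metric requires integrability. Orthonormality
    provides it: an integral equal to [1] is finite, so the diagonal entries of
    the fundamental tensor, being nonnegative, are integrable, and they dominate
    the others. *)
Lemma averaged_metric_orthonormal_succ p (b : 'I_n -> 'rV[R]_n) :
  (forall i j, gamma p (b i) (b j) = (i == j)%:R) ->
  forall x y : 'rV[R]_n,
  gamma p (\sum_(i < n) x 0 i *: b i) (\sum_(j < n) y 0 j *: b j) =
  \sum_(i < n) x 0 i * y 0 i.
Proof.
move=> ob x y; have [mu muV muE] := gammaF p.
have mS := indicatrix_measurable FF p.
pose f i j (v : T) := fund F p v (b i) (b j).
have mf i j : measurable_fun (indicatrix F p : set T) (f i j).
  apply: (@measurable_fun_continuous_on _ _ _ [set v | v != 0]) => //.
  - exact: nonzero_open.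
  - by move=> v; exact: (indicatrix_neq0 FF).
  - by move=> v; exact: (fund_continuous FF).
have fd i : mu.-integrable (indicatrix F p) (EFin \o f i i).
  apply/integrableP; split; first exact/measurable_EFinP.
  have := ob i i; rewrite muE eqxx /Rintegral => I1.
  rewrite (eq_integral (fun v => (f i i v)%:E)); last first.
    move=> v /set_mem Sv /=; congr (_%:E); rewrite ger0_norm //.
    by apply: fund_ge0; exact: (indicatrix_neq0 FF Sv).
  move: I1; rewrite /f; case: (integral _ _ _) => [r _|/= /esym/eqP|/= /esym/eqP];
    by rewrite ?ltry ?oner_eq0.
have fi i j : mu.-integrable (indicatrix F p) (EFin \o f i j).
  apply: (le_integrable mS _ _ (integrableD mS (fd i) (fd j))).
    exact/measurable_EFinP.
  move=> v Sv /=; rewrite lee_fin [leRHS]ger0_norm.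
    by apply: fund_normr_le; exact: (indicatrix_neq0 FF Sv).
  by apply: addr_ge0; apply: fund_ge0; exact: (indicatrix_neq0 FF Sv).
pose h i (v : T) := \sum_(j < n) y 0 j * f i j v.
have hI i := Rintegral_lincomb (fun j => y 0 j) mS (fi i).
have [_ E] := Rintegral_lincomb (fun i => x 0 i) mS (fun i => (hI i).1).
rewrite muE; transitivity (\int[mu]_(v in indicatrix F p) \sum_(i < n) x 0 i * h i v)%R.
  apply: eq_Rintegral => v _.
  apply: etrans (@scalar_sum _ _ _ (fun z => fund F p v z _) (fun i => x 0 i) b _) _.
    by move=> *; exact: fund_lin.
  apply: eq_bigr => i _; congr (_ * _).
  by apply: (@scalar_sum _ _ _ (fund F p v (b i)) (fun j => y 0 j) b) => *; exact: fund_linr.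
rewrite E; apply: eq_bigr => i _; congr (_ * _).
rewrite (hI i).2 (bigD1 i) //= big1 => [|j ji].
  by rewrite -muE ob eqxx mulr1 addr0.
by rewrite -muE ob eq_sym (negbTE ji) mulr0.
Qed.

End AveragedMetric.

(** * The connection at the centre of normal coordinates *)

Section PairCalculus.
Context {R : realType} {V V' W : normedModType R}.

Lemma is_derive_pair (f : R -> V) (g : R -> V') (t : R) (df : V) (dg : V') :
  is_derive t 1 f df -> is_derive t 1 g dg ->
  is_derive t 1 (fun s => (f s, g s)) (df, dg).
Proof.
move=> [df1 fE] [dg1 gE].
have dft : differentiable f t by exact/derivable1_diffP.
have dgt : differentiable g t by exact/derivable1_diffP.
have dp := differentiable_pair dft dgt.
apply: DeriveDef; first exact/(derivable1_diffP _ _).2.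
apply: etrans (deriveE _ dp) _; apply: etrans (congr1 (@^~ 1) (diff_pair dft dgt)) _.
exact: (congr2 pair (etrans (esym (deriveE _ dft)) fE) (etrans (esym (deriveE _ dgt)) gE)).
Qed.

Lemma derive_partial_l (Phi : V * V' -> W) (x a : V) (y : V') : differentiable Phi (x, y) ->
  'D_a (fun x => Phi (x, y)) x = 'd Phi (x, y) (a, 0).
Proof.
move=> dPhi; have di : differentiable (fun x : V => x) x by exact: ex_diff.
have dc : differentiable (fun=> y : V') x by exact: differentiable_cst.
have dp := differentiable_pair di dc.
have dcomp := differentiable_comp dp dPhi.
apply: etrans (deriveE _ dcomp) _; apply: etrans (diff_comp_at a dp dPhi) _.
congr ('d Phi _ _); apply: etrans (congr1 (@^~ a) (diff_pair di dc)) _.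
have i0 : 'd (fun x : V => x) x a = a by rewrite diff_val.
have c0 : 'd (fun=> y : V') x a = 0 by rewrite diff_cst.
exact: (congr2 pair i0 c0).
Qed.

Lemma derive_partial_r (Phi : V * V' -> W) (x : V) (y b : V') : differentiable Phi (x, y) ->
  'D_b (fun y => Phi (x, y)) y = 'd Phi (x, y) (0, b).
Proof.
move=> dPhi; have di : differentiable (fun y : V' => y) y by exact: ex_diff.
have dc : differentiable (fun=> x : V) y by exact: differentiable_cst.
have dp := differentiable_pair dc di.
have dcomp := differentiable_comp dp dPhi.
apply: etrans (deriveE _ dcomp) _; apply: etrans (diff_comp_at b dp dPhi) _.
congr ('d Phi _ _); apply: etrans (congr1 (@^~ b) (diff_pair dc di)) _.
have i0 : 'd (fun y : V' => y) y b = b by rewrite diff_val.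
have c0 : 'd (fun=> x : V) y b = 0 by rewrite diff_cst.
exact: (congr2 pair c0 i0).
Qed.

End PairCalculus.

(** Polarization. *)
Lemma quadratic_form_zero {R : realType} n (C : 'I_n -> 'I_n -> R) :
  (forall a : 'rV[R]_n, \sum_(i < n) \sum_(j < n) C i j * a 0 i * a 0 j = 0) ->
  forall i j, C i j + C j i = 0.
Proof.
move=> C0; pose b (x y : 'rV[R]_n) := \sum_(i < n) \sum_(j < n) C i j * x 0 i * y 0 j.
have bE i j : b (unit_row R i) (unit_row R j) = C i j.
  rewrite /b (bigD1 i) //= [X in _ + X]big1 ?addr0 => [|k ki]; last first.
    by rewrite big1 // => l _; rewrite !mxE (negbTE ki) andbF mulr0 mul0r.
  rewrite (bigD1 j) //= big1 ?addr0 => [|l lj].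
    by rewrite !mxE !eqxx !mulr1.
  by rewrite !mxE (negbTE lj) andbF mulr0.
have bD x y : b (x + y) (x + y) = b x x + b x y + (b y x + b y y).
  rewrite /b -!big_split; apply: eq_bigr => i _ /=; rewrite -!big_split; apply: eq_bigr => j _ /=.
  by rewrite !mxE; ring.
move=> i j; have bz x : b x x = 0 by exact: C0.
by have := bD (unit_row R i) (unit_row R j); rewrite !bz !bE add0r addr0.
Qed.

(** The two difference quotients coincide, so [f] may be replaced by its values on
    a line even if it is not known to be differentiable; the averaged metric is
    such an [f]. *)
Lemma derive_at0 {R : realType} (V W : normedModType R) (f : V -> W) (v : V) :
  'D_v f 0 = 'D_1 (fun t : R => f (t *: v)) 0.
Proof.
have E : (fun h : R => h^-1 *: ((f \o shift 0) (h *: v) - f 0)) =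
    (fun h : R => h^-1 *: (((fun t : R => f (t *: v)) \o shift 0) (h *: 1) - f (0 *: v))).
  by apply/funext => h /=; rewrite !addr0 scale0r [h *: 1]mulr1.
exact: (congr1 (fun g : R -> W => lim (g @ 0^')) E).
Qed.

(** In dimension zero there is no radial parametrization, but the sum defining the
    fundamental tensor is empty. *)
Lemma averaged_metric_dim0 {R : realType} (M : topologicalType) (F : M -> 'rV[R]_0 -> R)
    (gamma : M -> 'rV[R]_0 -> 'rV[R]_0 -> R) (p : M) X Y :
  averaged_metric F gamma -> gamma p X Y = 0.
Proof.
move=> /(_ p) [mu _ ->]; rewrite /Rintegral (eq_integral (cst 0%E)) ?integral0 //.
by move=> v _; rewrite /fund big_ord0.
Qed.

Lemma averaged_metric_isometry {R : realType} n (M : topologicalType)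
    (S : smooth_manifold R n M) (F : M -> 'rV[R]_n -> R)
    (gamma : M -> 'rV[R]_n -> 'rV[R]_n -> R) (p q : M)
    (A A' : {linear 'rV[R]_n -> 'rV[R]_n}) :
  finsler_metric S F -> averaged_metric F gamma ->
  cancel A A' -> cancel A' A -> (forall w, F q (A w) = F p w) ->
  forall X Y, gamma q (A X) (A Y) = gamma p X Y.
Proof.
case: n M S F gamma p q A A' => [|m] M S F gamma p q A A' FF gF.
  by move=> *; rewrite !(averaged_metric_dim0 _ _ _ gF).
exact: (averaged_metric_isometry_succ FF gF).
Qed.

Lemma averaged_metric_orthonormal {R : realType} n (M : topologicalType)
    (S : smooth_manifold R n M) (F : M -> 'rV[R]_n -> R)
    (gamma : M -> 'rV[R]_n -> 'rV[R]_n -> R) (p : M) (b : 'I_n -> 'rV[R]_n) :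
  finsler_metric S F -> averaged_metric F gamma ->
  (forall i j, gamma p (b i) (b j) = (i == j)%:R) ->
  forall x y : 'rV[R]_n,
  gamma p (\sum_(i < n) x 0 i *: b i) (\sum_(j < n) y 0 j *: b j) =
  \sum_(i < n) x 0 i * y 0 i.
Proof.
case: n M S F gamma p b => [|m] M S F gamma p b FF gF.
  by move=> _ x y; rewrite (averaged_metric_dim0 _ _ _ gF) big_ord0.
exact: (averaged_metric_orthonormal_succ FF gF).
Qed.

Definition chart_mapping {R : realType} {n : nat} {M : topologicalType}
    (S : smooth_manifold R n M) (u : chart R n M) (q q' : M) (N : 'M[R]_n)
    (w : 'rV[R]_n) : 'rV[R]_n :=
  tvec S u q' (tcoord S u q w *m N).

Section ChartMapping.
Context {R : realType} {n : nat} {M : topologicalType}.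
Variables (S : smooth_manifold R n M) (u : chart R n M).

Fact chart_mapping_linear (q q' : M) (N : 'M[R]_n) : linear (chart_mapping S u q q' N).
Proof. by move=> a x y; rewrite /chart_mapping linearP mulmxDl -scalemxAl linearP. Qed.
HB.instance Definition _ (q q' : M) (N : 'M[R]_n) :=
  GRing.isLinear.Build R 'rV[R]_n 'rV[R]_n _ (chart_mapping S u q q' N)
    (chart_mapping_linear q q' N).

Lemma chart_mapping_cancel (q q' : M) (N N' : 'M[R]_n) : atlas S u ->
  chart_dom u q -> chart_dom u q' -> N *m N' = 1%:M ->
  cancel (chart_mapping S u q q' N) (chart_mapping S u q' q N').
Proof.
move=> au uq uq' NN w; rewrite /chart_mapping tvecK // -mulmxA NN mulmx1.
exact: tcoordK.
Qed.

End ChartMapping.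

Section SemiSymmetricCompatible.
Context {R : realType} {n : nat} {M : topologicalType}.
Variables (S : smooth_manifold R n M) (F : M -> 'rV[R]_n -> R).
Variable nabla : (M -> 'rV[R]_n) -> (M -> 'rV[R]_n) -> M -> 'rV[R]_n.
Variable rho : M -> 'rV[R]_n -> R.
Variable gamma : M -> 'rV[R]_n -> 'rV[R]_n -> R.
Variables (p : M) (u : chart R n M).
Hypothesis FF : finsler_metric S F.
Hypothesis nablaC : linear_connection S nabla.
Hypothesis semisym : semi_symmetric_with S nabla rho.
Hypothesis compat : compatible S F nabla.
Hypothesis gammaF : averaged_metric F gamma.
Hypothesis u_normal : normal_coordinates S gamma p u.
Hypothesis u_on : orthonormal_frame S gamma p u.

Let au : atlas S u. Proof. by case: u_normal. Qed.
Let up : chart_dom u p. Proof. by case: u_normal. Qed.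
Let up0 : u p = 0. Proof. by case: u_normal. Qed.
Let img0 : chart_img u 0. Proof. by rewrite -up0; exact: chart_img_map. Qed.
Let inv0 : chart_inv u 0 = p. Proof. by rewrite -up0 chart_mapK. Qed.

Local Notation Gam i j k := (conn_coef S nabla u p i j k).
Local Notation rho_ i := (rho p (coord_field S u i p)).

(** Coordinate fields commute, so the torsion is the antisymmetric part of the
    coefficients. *)
Lemma conn_coef_torsion i j k :
  Gam i j k - Gam j i k = rho_ j * (i == k)%:R - rho_ i * (j == k)%:R.
Proof.
have cs l : smooth_field_near S p (coord_field S u l) by exact: coord_field_smooth.
have := semisym (cs i) (cs j); rewrite /torsion lie_bracket_coord_field // subr0 => T.
have := congr1 (fun v => tcoord S u p v 0 k) T.
rewrite !linearB !linearZZ /= /coord_field !tvecK //.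
by rewrite !mxE /conn_coef !eqxx /= ![k == _]eq_sym.
Qed.

Lemma averaged_metric_coord (x y : 'rV[R]_n) :
  gamma p (tvec S u p x) (tvec S u p y) = \sum_(i < n) x 0 i * y 0 i.
Proof.
rewrite !tvec_sum; exact: (averaged_metric_orthonormal FF gammaF).
Qed.

Local Notation Bmx a := (\matrix_(j, k) \sum_(i < n) a 0 i * Gam i j k : 'M[R]_n).

Let line_smooth a :
  smooth_curve S [set t | chart_img u (t *: a)] (fun t => chart_inv u (t *: a)).
Proof. by case: u_normal => _ _ _ _ /(_ a) []. Qed.

(** Parallel frames are isometric images of the orthonormal frame at [p], hence
    the matrix of [gamma] along the line is [Z *m Z^T], with [Z] the inverse of the
    frame; the derivative of [Z] at [p] is the connection matrix. *)
Lemma averaged_metric_derive (a : 'rV[R]_n) j k :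
  'D_a (fun z => metric_mx S gamma u z j k) 0 = Bmx a j k + Bmx a k j.
Proof.
have [d [Y [Z [d0 [Y0 Z0] [dY dZ] YZ par]]]] := parallel_frame nablaC au up up0 (line_smooth a).
pose c t := chart_inv u (t *: a).
have c0 : c 0 = p by rewrite /c scale0r inv0.
have ct (t : R) : `|t| < d -> chart_dom u (c t).
  by move=> /YZ [_ /chart_img_inv []].
have E (t : R) : `|t| < d -> metric_mx S gamma u (t *: a) j k = \sum_(l < n) Z t j l * Z t k l.
  move=> td; have [YZt _] := YZ t td; have ZYt := mulmx1C YZt.
  have AK := chart_mapping_cancel au up (ct t td) YZt.
  have A'K := chart_mapping_cancel au (ct t td) up ZYt.
  have AF w : F (c t) (chart_mapping S u p (c t) (Y t) w) = F p w.
    have := compat (par (tcoord S u p w) t td).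
    by rewrite -/(c t) -/(c 0) c0 tcoordK.
  have iso := averaged_metric_isometry FF gammaF AK A'K AF.
  have key (x y : 'rV[R]_n) : gamma (c t) (tvec S u (c t) x) (tvec S u (c t) y) =
      \sum_(l < n) (x *m Z t) 0 l * (y *m Z t) 0 l.
    rewrite -averaged_metric_coord -(iso (tvec S u p (x *m Z t)) (tvec S u p (y *m Z t))).
    have AE (z : 'rV[R]_n) :
        chart_mapping S u p (c t) (Y t) (tvec S u p (z *m Z t)) = tvec S u (c t) z.
      by rewrite /chart_mapping tvecK // -mulmxA ZYt mulmx1.
    exact: (esym (congr2 (gamma (c t)) (AE x) (AE y))).
  rewrite mxE -/(c t) /coord_field key; apply: eq_bigr => l _.
  by rewrite /unit_row -!rowE ![row _ _ _ _]mxE.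
rewrite derive_at0.
have dS : is_derive (0 : R) 1 (fun t => \sum_(l < n) Z t j l * Z t k l)
    (\sum_(l < n) (Z 0 j l * Bmx a k l + Z 0 k l * Bmx a j l)).
  have BE i l : (\matrix_(j, k) \sum_(i < n) a 0 i * conn_coef S nabla u
      (chart_inv u (0 *: a)) i j k : 'M[R]_n) i l = Bmx a i l.
    by rewrite !mxE -/(c 0) c0.
  apply: (@is_derive_sumE _ _ _ n (fun l t => Z t j l * Z t k l)
    (fun l => Z 0 j l * Bmx a k l + Z 0 k l * Bmx a j l)) => l.
  have dj := dZ j l; have dk := dZ k l; rewrite BE in dj; rewrite BE in dk.
  exact: is_deriveM.
have -> : 'D_1 (fun t : R => metric_mx S gamma u (t *: a) j k) 0 =
    'D_1 (fun t => \sum_(l < n) Z t j l * Z t k l) 0.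
  apply: near_eq_derive; have := @nbhsx_ballx _ R 0 d d0.
  by apply: filterS => t; rewrite -ball_normE /= sub0r normrN; exact: E.
rewrite (@derive_val _ _ _ _ _ _ _ dS) Z0 big_split /= addrC; congr (_ + _).
  rewrite (bigD1 k) //= [1%:M _ _]mxE eqxx mul1r big1 ?addr0 // => l lk.
  by rewrite [1%:M _ _]mxE eq_sym (negbTE lk) mul0r.
rewrite (bigD1 j) //= [1%:M _ _]mxE eqxx mul1r big1 ?addr0 // => l lj.
by rewrite [1%:M _ _]mxE eq_sym (negbTE lj) mul0r.
Qed.

Lemma Bmx_unit i j k : Bmx (unit_row R i) j k = Gam i j k.
Proof.
rewrite mxE (bigD1 i) //= big1 ?addr0 => [|l li]; first by rewrite !mxE !eqxx mul1r.
by rewrite !mxE (negbTE li) andbF mul0r.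
Qed.

Lemma christoffel_at_center i j k :
  christoffel S gamma u i j k 0 =
  2^-1 * ((Gam i j k + Gam i k j) + (Gam j i k + Gam j k i) - (Gam k i j + Gam k j i)).
Proof.
have mx1 : metric_mx S gamma u 0 = 1%:M.
  by apply/matrixP => a b; rewrite mxE inv0 u_on mxE.
rewrite /christoffel mx1 invmx1 (bigD1 k) //= big1 ?addr0 => [|l lk].
  by rewrite mxE eqxx mul1r !averaged_metric_derive !Bmx_unit.
by rewrite mxE eq_sym (negbTE lk) mul0r.
Qed.

(** The rays through the centre are geodesics without acceleration. *)
Lemma christoffel_quadratic (a : 'rV[R]_n) k :
  \sum_(i < n) \sum_(j < n) christoffel S gamma u i j k 0 * a 0 i * a 0 j = 0.
Proof.
have [_ _ _ _ /(_ a) [_ geo]] := u_normal.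
have Oimg : open [set t : R | chart_img u (t *: a)].
  have linec : continuous (fun t : R => t *: a).
    by move=> t; apply: cvgZr_tmp; exact: cvg_id.
  rewrite openE => t It; apply: (linec t).
  by apply: open_nbhs_nbhs; split => //; exact: chart_img_open.
have I0 : chart_img u ((0 : R) *: a) by rewrite scale0r.
have dom0 : chart_dom u (chart_inv u ((0 : R) *: a)) by rewrite scale0r inv0.
have := geo 0 u I0 au dom0 k; rewrite /= scale0r inv0 up0.
have near_line (t : R) : chart_img u (t *: a) ->
    \forall s \near t, u (chart_inv u (s *: a)) = s *: a.
  move=> It; have : \forall s \near t, chart_img u (s *: a) by exact: open_nbhs_nbhs.
  by apply: filterS => s /chart_img_inv [].
have dline (t : R) : chart_img u (t *: a) -> derive1 (fun s => u (chart_inv u (s *: a))) t = a.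
  move=> It; rewrite derive1E (near_eq_derive _ (near_line t It)).
  have := @is_derive_line R _ _ id 0 a t (@ex_diff _ _ _ _ _ _ _ (is_diff_id (0 + t *: a))).
  rewrite derive_id => dl.
  rewrite (_ : (fun s => _) = (fun s => id (0 + s *: a))); first exact: derive_val.
  by apply/funext => s; rewrite add0r.
have -> : derive1 (derive1 (fun s : R => u (chart_inv u (s *: a)))) 0 = 0.
  rewrite derive1E (near_eq_derive (g := cst a)); first exact: derive_cst.
  have : \forall s \near (0 : R), chart_img u (s *: a) by exact: open_nbhs_nbhs.
  by apply: filterS => s; exact: dline.
by rewrite mxE add0r dline.
Qed.

(** As for the Levi-Civita connection, the symmetrized Christoffel equation and the
    torsion identities for three arrangements of the indices are linear equations
    that can be solved for one coefficient. *)
Lemma conn_coef_center i j k :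
  Gam i j k = rho_ j * (i == k)%:R - rho_ k * (i == j)%:R.
Proof.
have C := quadratic_form_zero (fun a => christoffel_quadratic a k) i j.
rewrite !christoffel_at_center in C.
have T1 := conn_coef_torsion i j k; have T2 := conn_coef_torsion i k j.
have T3 := conn_coef_torsion j k i.
move: C T1 T2 T3; rewrite [k == j]eq_sym [k == i]eq_sym [j == i]eq_sym; lra.
Qed.

Local Notation Phi := (fun z : 'rV[R]_n * 'rV[R]_n => F_loc S F u z.1 z.2).

Lemma F_loc_differentiable (v : 'rV[R]_n) : v != 0 -> differentiable Phi (u p, v).
Proof. by move=> v0; apply: (finsler_smooth FF au 1%N).1; split => //; rewrite up0. Qed.

(** Along the [i]-th coordinate line the parallel field that starts at [v] has
    the velocity [- (v *m Bmx a)] at [p], and [F] is constant along it; the chain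
    rule turns this into an equation between partial derivatives. *)
Lemma dFdx_center i (v : 'rV[R]_n) : v != 0 ->
  dFdx S F u p i v = \sum_(k < n) (\sum_(j < n) v 0 j * Gam i j k) * dFdy S F u p k v.
Proof.
move=> v0; set a := unit_row R i.
have [d [Y [Z [d0 [Y0 Z0] [dY _] YZ par]]]] := parallel_frame nablaC au up up0 (line_smooth a).
have dPhi := F_loc_differentiable v0.
have cst t : `|t| < d -> Phi (u p + t *: a, v *m Y t) = F p (tvec S u p v).
  move=> td; have := compat (par v t td).
  by rewrite scale0r inv0 up0 add0r.
have dy : is_derive (0 : R) 1 (fun t => v *m Y t) (- (v *m Bmx a)).
  apply/is_derive_rowP => k.
  rewrite (_ : (fun s => _) = fun s => \sum_(i < n) v 0 i * Y s i k); last first.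
    by apply/funext => s; rewrite mxE.
  rewrite (_ : (- (v *m Bmx a)) 0 k = \sum_(j < n) v 0 j * (- Bmx a j k)); last first.
    by rewrite mxE mxE -sumrN; apply: eq_bigr => j _; rewrite mulrN.
  apply: (@is_derive_sumE _ _ _ n (fun j s => v 0 j * Y s j k)) => j.
  apply: (is_deriveZ (v 0 j)); have := dY j k; congr (is_derive _ _ _ (- _)).
  by rewrite !mxE; apply: eq_bigr => l _; rewrite scale0r inv0.
have dx : is_derive (0 : R) 1 (fun t : R => u p + t *: a) a.
  have := @is_derive_line R _ _ id (u p) a 0 (@ex_diff _ _ _ _ _ _ _ (is_diff_id (u p + 0 *: a))).
  by rewrite derive_id.
have z0 : (u p + (0 : R) *: a, v *m Y 0) = (u p, v) by rewrite scale0r addr0 Y0 mulmx1.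
have dPhi0 : differentiable Phi (u p + (0 : R) *: a, v *m Y 0) by rewrite z0.
have dc := is_derive_comp_curve (is_derive_pair dx dy) dPhi0.
have d0' : 'd Phi (u p, v) (a, - (v *m Bmx a)) = 0.
  rewrite -z0; apply: etrans (esym (@derive_val _ _ _ _ _ _ _ dc)) _.
  apply: etrans (near_eq_derive (g := fun=> F p (tvec S u p v)) _ _) (derive_cst _ _ _).
  have := @nbhsx_ballx _ R 0 d d0.
  by apply: filterS => t; rewrite -ball_normE /= sub0r normrN; exact: cst.
have dfst : dFdx S F u p i v = 'd Phi (u p, v) (a, 0) by exact: derive_partial_l.
have dsnd (w : 'rV[R]_n) : 'D_w (fun y => F_loc S F u (u p) y) v = 'd Phi (u p, v) (0, w).
  exact: derive_partial_r.
have df2 : differentiable (fun y => F_loc S F u (u p) y) v.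
  by apply: (@differentiable_comp _ _ _ _ (fun y => (u p, y)) Phi).
have -> : dFdx S F u p i v = 'd Phi (u p, v) (0, v *m Bmx a).
  rewrite dfst; apply/eqP; rewrite -subr_eq0; apply/eqP; apply: etrans _ d0'.
  apply: etrans (esym (linearB _ _ _)) _; congr ('d _ _ _).
  by congr pair; rewrite /= ?subr0 // sub0r.
rewrite -dsnd derive_sum_unit //; apply: eq_bigr => k _; congr (_ * _).
by rewrite mxE; apply: eq_bigr => j _; rewrite Bmx_unit.
Qed.

Local Notation rho_row v := (\sum_(j < n) v 0 j * rho_ j).

(** By [conn_coef_center], the partial derivatives along the base and along the
    fibre, the latter times [rho(v)], differ by [v 0 k] times a number independent
    of [k], which cancels in the antisymmetrization. *)
Lemma f_h_center i j (v : 'rV[R]_n) : v != 0 ->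
  f_h S F u p i j v = rho_row v * f_v S F u p i j v.
Proof.
move=> v0.
have dE k : dFdx S F u p k v = rho_row v * dFdy S F u p k v -
    v 0 k * \sum_(l < n) rho_ l * dFdy S F u p l v.
  rewrite dFdx_center //.
  transitivity (\sum_(l < n) ((rho_row v * (k == l)%:R) * dFdy S F u p l v -
      v 0 k * (rho_ l * dFdy S F u p l v))).
    apply: eq_bigr => l _; rewrite mulrA -mulrBl; congr (_ * _).
    transitivity (\sum_(j < n) (v 0 j * rho_ j * (k == l)%:R - v 0 j * (k == j)%:R * rho_ l)).
      by apply: eq_bigr => m _; rewrite conn_coef_center; ring.
    rewrite sumrB -!mulr_suml; congr (_ - _ * _).
    rewrite (bigD1 k) //= eqxx mulr1 big1 ?addr0 // => m mk.
    by rewrite eq_sym (negbTE mk) mulr0.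
  rewrite sumrB -mulr_sumr; congr (_ - _); move: (rho_row v) => r.
  rewrite (bigD1 k) //= eqxx mulr1 big1 ?addr0 // => l lk.
  by rewrite eq_sym (negbTE lk) mulr0 mul0r.
by rewrite /f_h /f_v !dE; ring.
Qed.

(** The frame is orthonormal, so this point is at distance exactly [eps]. *)
Lemma metric_closed_ball_vertex (v : 'rV[R]_n) (eps : R) l : 0 < eps ->
  metric_closed_ball S gamma u p v eps (v - eps *: unit_row R l).
Proof.
move=> e0; rewrite /metric_closed_ball /= averaged_metric_coord addrAC subrr add0r.
rewrite (bigD1 l) //= big1 => [|k kl]; last by rewrite !mxE (negbTE kl) andbF mulr0 oppr0 mulr0.
by rewrite !mxE !eqxx mulr1 addr0 mulrNN -expr2 sqrtr_sqr ger0_norm // ltW.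
Qed.

End SemiSymmetricCompatible.

Theorem theorem2 (R : realType) (n : nat) (M : topologicalType)
    (S : smooth_manifold R n M) (F : M -> 'rV[R]_n -> R)
    (nabla : (M -> 'rV[R]_n) -> (M -> 'rV[R]_n) -> M -> 'rV[R]_n)
    (rho : M -> 'rV[R]_n -> R)
    (gamma : M -> 'rV[R]_n -> 'rV[R]_n -> R)
    (p : M) (u : chart R n M) (v : 'rV[R]_n) (eps : R) (i j : 'I_n)
    (M_connected : connected [set: M])
    (F_finsler : finsler_metric S F)
    (F_nonriem : ~ riemannian_finsler S F)
    (nabla_conn : linear_connection S nabla)
    (rho_form : one_form S rho)
    (nabla_semisym : semi_symmetric_with S nabla rho)
    (nabla_compat : compatible S F nabla)
    (gamma_avg : averaged_metric F gamma)
    (u_normal : normal_coordinates S gamma p u)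
    (u_orthonormal : orthonormal_frame S gamma p u)
    (v_neq0 : v != 0)
    (v_nvc : ~ vertically_contact S F u p v)
    (eps_gt0 : 0 < eps)
    (eps_neq : eps != \sum_(l < n) v 0 l)
    (ball_neq0 : forall w, metric_closed_ball S gamma u p v eps w -> w != 0)
    (ball_nvc : forall w, metric_closed_ball S gamma u p v eps w ->
       ~ vertically_contact S F u p w)
    (i_neq_j : i != j)
    (f_neq0 : forall w, metric_closed_ball S gamma u p v eps w ->
       f_v S F u p i j w != 0) :
  let vtilde := \sum_(l < n) v 0 l in
  let w (l : 'I_n) := v - eps *: unit_row R l in
  let q (l : 'I_n) := f_h S F u p j i (w l) / f_v S F u p j i (w l) in
  forall k : 'I_n,
    rho p (coord_field S u k p) =
    1 / eps * (1 / (vtilde - eps) * (\sum_(l < n) v 0 l * q l) - q k).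
Proof.
move=> vtilde w q k.
have wb l : metric_closed_ball S gamma u p v eps (w l).
  exact: (metric_closed_ball_vertex F_finsler gamma_avg u_orthonormal).
pose r l := rho p (coord_field S u l p).
pose s := \sum_(l < n) v 0 l * r l.
(* The quotient is the value of [rho] at [w l]. *)
have qE l : q l = s - eps * r l.
  have f_neq : f_v S F u p j i (w l) != 0.
    have -> : f_v S F u p j i (w l) = - f_v S F u p i j (w l) by rewrite /f_v opprB.
    by rewrite oppr_eq0; apply: f_neq0.
  rewrite /q (f_h_center F_finsler nabla_conn nabla_semisym nabla_compat gamma_avg
    u_normal u_orthonormal) ?ball_neq0 // mulfK //.
  transitivity (\sum_(m < n) (v 0 m * r m - eps * ((m == l)%:R * r m))).
    by apply: eq_bigr => m _; rewrite !mxE eqxx /= /r; ring.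
  rewrite sumrB -mulr_sumr; congr (_ - _ * _).
  rewrite (bigD1 l) //= eqxx mul1r big1 ?addr0 // => m ml.
  by rewrite (negbTE ml) mul0r.
have -> : \sum_(l < n) v 0 l * q l = s * (vtilde - eps).
  transitivity (\sum_(l < n) (s * v 0 l - eps * (v 0 l * r l))).
    by apply: eq_bigr => l _; rewrite qE; ring.
  by rewrite sumrB -!mulr_sumr -/s -/vtilde; ring.
have d0 : vtilde - eps != 0 by rewrite subr_eq0 eq_sym.
have e0 : eps != 0 by rewrite gt_eqF.
have -> : 1 / (vtilde - eps) * (s * (vtilde - eps)) = s by rewrite mulrCA div1r mulVf ?mulr1.
by rewrite qE opprB addrC subrK div1r mulKf.
Qed.
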